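(* Let $d \ge 2$ and let $p > d$ be a prime. Let $L$ be a representation of $G$ over $\mathbb F_p$ such that $\dim L^{G(n)} \ll_L p^{-n} |G : G(n)|$ for all $n \ge 1$. Then \[ \dim L^{T G(n)} \ll_L 10^{(d-1)n} p^{-(2/3)^{d-1} n} |G : T G(n)| \] for all $n \ge 1$.
   Context: $G(n) = \{ g \in SL_d(\mathbb Z_p) : g \equiv 1 \pmod{p^n}\}$ for $n \ge 1$, $G = G(1)$, and $T$ is the subgroup of diagonal matrices in $G$. $L^H$ denotes the subspace of vectors fixed by a subgroup $H$. *)

(* Defs.v *)
From HB Require Import structures.
From mathcomp Require Import all_boot all_order all_algebra.
From mathcomp Require Import finmap.
From mathcomp Require Import boolp classical_sets cardinality.
From mathcomp Require Import reals constructive_ereal ereal exp.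

Set Implicit Arguments.
Unset Strict Implicit.
Unset Printing Implicit Defensive.

Import Order.TTheory GRing.Theory Num.Theory.

Local Open Scope classical_set_scope.

(* The ring of p-adic integers, as the inverse limit of the rings Z/p^n: a
   p-adic integer is a sequence of residues x n in {0, .., p^n - 1} such that
   x n.+1 reduces to x n modulo p^n.  As in 'Z_p, the parameter p is silently
   replaced by 2 when p <= 1, so that the ring is never trivial. *)
Definition padic_base (p : nat) : nat := (Zp_trunc p).+2.

Record padic_int (p : nat) := PadicInt {
  padic_res :> nat -> nat;
  padic_resP : forall n, padic_res n.+1 %% padic_base p ^ n = padic_res n
}.

Section PadicRing.
Variable p : nat.
Local Notation b := (padic_base p).
Implicit Types x y z : padic_int p.

HB.instance Definition _ := gen_eqMixin (padic_int p).
HB.instance Definition _ := gen_choiceMixin (padic_int p).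

Lemma padic_eq x y : (forall n, x n = y n) -> x = y.
Proof.
case: x y => [f Hf] [g Hg] /= /funext e; subst g.
by rewrite (Prop_irrelevance Hf Hg).
Qed.

Lemma padic_mod x n : x n %% b ^ n = x n.
Proof. by rewrite -(padic_resP x n) modn_mod. Qed.

Lemma padic_dvd n : b ^ n %| b ^ n.+1.
Proof. by rewrite dvdn_exp2l. Qed.

Lemma padic_lt x n : x n < b ^ n.
Proof. by rewrite -padic_mod ltn_mod expn_gt0. Qed.

Fact padic_natP k n : (k %% b ^ n.+1) %% b ^ n = k %% b ^ n.
Proof. exact/modn_dvdm/padic_dvd. Qed.
Definition padic_nat k := PadicInt (padic_natP k).

Fact padic_addP x y n :
  ((x n.+1 + y n.+1) %% b ^ n.+1) %% b ^ n = (x n + y n) %% b ^ n.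
Proof. by rewrite (modn_dvdm _ (padic_dvd n)) -modnDm !padic_resP. Qed.
Definition padic_add x y := PadicInt (padic_addP x y).

Fact padic_mulP x y n :
  ((x n.+1 * y n.+1) %% b ^ n.+1) %% b ^ n = (x n * y n) %% b ^ n.
Proof. by rewrite (modn_dvdm _ (padic_dvd n)) -modnMm !padic_resP. Qed.
Definition padic_mul x y := PadicInt (padic_mulP x y).

Fact padic_oppP x n :
  ((b ^ n.+1 - x n.+1) %% b ^ n.+1) %% b ^ n = (b ^ n - x n) %% b ^ n.
Proof.
rewrite (modn_dvdm _ (padic_dvd n)); apply/eqP.
rewrite -(eqn_modDr (x n.+1)) subnK; last exact/ltnW/padic_lt.
rewrite -(modnDmr _ (x n.+1)) padic_resP subnK; last exact/ltnW/padic_lt.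
by rewrite modnn; exact: padic_dvd.
Qed.
Definition padic_opp x := PadicInt (padic_oppP x).

Fact padic_addA : associative padic_add.
Proof. by move=> x y z; apply: padic_eq => n /=; rewrite modnDmr modnDml addnA. Qed.
Fact padic_addC : commutative padic_add.
Proof. by move=> x y; apply: padic_eq => n /=; rewrite addnC. Qed.
Fact padic_add0 : left_id (padic_nat 0) padic_add.
Proof. by move=> x; apply: padic_eq => n /=; rewrite mod0n add0n padic_mod. Qed.
Fact padic_addN : left_inverse (padic_nat 0) padic_opp padic_add.
Proof.
move=> x; apply: padic_eq => n /=.
by rewrite modnDml subnK ?modnn ?mod0n //; exact/ltnW/padic_lt.
Qed.
HB.instance Definition _ := GRing.isZmodule.Build (padic_int p)
  padic_addA padic_addC padic_add0 padic_addN.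

Fact padic_mulA : associative padic_mul.
Proof. by move=> x y z; apply: padic_eq => n /=; rewrite modnMmr modnMml mulnA. Qed.
Fact padic_mulC : commutative padic_mul.
Proof. by move=> x y; apply: padic_eq => n /=; rewrite mulnC. Qed.
Fact padic_mul1 : left_id (padic_nat 1) padic_mul.
Proof. by move=> x; apply: padic_eq => n /=; rewrite modnMml mul1n padic_mod. Qed.
Fact padic_mulD : left_distributive padic_mul padic_add.
Proof.
by move=> x y z; apply: padic_eq => n /=; rewrite modnMml modnDm mulnDl.
Qed.
Fact padic_1neq0 : padic_nat 1 != padic_nat 0.
Proof. by apply/eqP => /(congr1 (fun x => padic_res x 1)). Qed.
HB.instance Definition _ := GRing.Zmodule_isComNzRing.Build (padic_int p)
  padic_mulA padic_mulC padic_mul1 padic_mulD padic_1neq0.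

End PadicRing.

Local Open Scope ring_scope.

Section CongruenceSubgroups.
Variables p d : nat.
Local Notation M := 'M[padic_int p]_d.

Definition SLd : set M := [set g | \det g = 1].

Definition congr_mod (n : nat) (g h : M) : Prop :=
  exists X : M, g - h = p%:R ^+ n *: X.

Definition Gn (n : nat) : set M := [set g | SLd g /\ congr_mod n g 1%:M].

Definition G1 : set M := Gn 1.

Definition diagT : set M := [set g | G1 g /\ is_diag_mx g].

Definition setmul (A B : set M) : set M := [set a *m b | a in A & b in B].

Definition left_cosets (K H : set M) : set (set M) :=
  [set setmul [set g] H | g in K].

(* |K : H|, when finite (fset_set of an infinite set is empty); every
   H used below is open in the compact group K. *)
Definition group_index (K H : set M) : nat := #|` fset_set (left_cosets K H) |.

(* Analogue of mx_repr for a representation on a possibly infinite-dimensional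
   space; the values of rho outside K are irrelevant. *)
Definition is_repr (F : fieldType) (L : lmodType F) (K : set M)
    (rho : M -> {linear L -> L}) : Prop :=
  (forall v, rho 1%:M v = v) /\
  (forall g h, K g -> K h -> forall v, rho (g *m h) v = rho g (rho h v)).

Definition fixed (F : fieldType) (L : lmodType F)
    (rho : M -> {linear L -> L}) (H : set M) : set L :=
  [set v | forall g, H g -> rho g v = v].

End CongruenceSubgroups.

Definition is_basis (F : fieldType) (L : lmodType F) (W : set L) (m : nat)
    (e : 'I_m -> L) : Prop :=
  [/\ forall i, W (e i),
      forall c : 'I_m -> F, \sum_i c i *: e i = 0 -> forall i, c i = 0 &
      forall v, W v -> exists c : 'I_m -> F, v = \sum_i c i *: e i].

(* The size of a finite basis of the subspace W, and +oo if there is none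
   (the infimum of the empty set). *)
Definition edim (R : realType) (F : fieldType) (L : lmodType F)
    (W : set L) : \bar R :=
  ereal_inf [set m%:R%:E | m in [set m | exists e : 'I_m -> L, is_basis W e]].

(* Main.v *)
Require Import Defs.
From HB Require Import structures.
From mathcomp Require Import all_boot all_order all_algebra.
From mathcomp Require Import finmap.
From mathcomp Require Import boolp classical_sets cardinality.
From mathcomp Require Import reals constructive_ereal ereal exp.
From mathcomp Require Import zify ring lra.

Set Implicit Arguments.
Unset Strict Implicit.
Unset Printing Implicit Defensive.

Import Order.TTheory GRing.Theory Num.Theory.

(* For 1 <= c <= d let H(c, k, n) be the group of all g in G that are diagonal
   mod p^n, with g_00 = ... = g_(c-1)(c-1) mod p^n and g_cc = g_00 mod p^k.  These
   groups interpolate between G(n) and T G(n): H(1, 1, n) = T G(n), H(c, n, n) =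
   H(c+1, 1, n), and H(d, 1, n) contains G(n).

   Let K = H(c, k, n), N = H(c, k+1, n+1) and W = L^N, with k < n.  Conjugating a
   diagonal generator t of H(c, k, n+1) mod N by elements of G that are 1 mod
   p^(n-k) and live in the SL_2 at the coordinates 0, c gives p elements
   g_0, ..., g_(p-1) of K, which lie on a conic in the elementary abelian group
   K / N.  All fixed spaces W^(g_i) have at least the dimension D of
   L^H(c, k, n+1), while any three of the g_i generate, together with the
   remaining coordinates, all of K.

   For commuting endomorphisms f_i one has
     sum_i dim ker f_i <= dim W + sum_(i < j) dim (ker f_i /\ ker f_j),
   since the product of the f_j kills the sum of their kernels.  Applied to W and
   to each ker f_i, f_i = g_i - 1, this gives D^3 <= 16 r (dim W)^2 with
   r = p^e dim L^K, where p^(e+2) is the index contributed by one step n -> n+1.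
   In terms of normalised dimensions a(H) = dim L^H / |G : H| this reads
     a(c, k, n+1)^3 <= 16 a(c, k, n) a(c, k+1, n+1)^2,
   and solving the recursion turns a saving q^(-n) for H(c+1, 1, n) into
   10^n q^(-2n/3) for H(c, 1, n). *)

(** * Kernels of commuting endomorphisms *)

Section PairSum.
Local Open Scope nat_scope.
Variable I : eqType.

Fixpoint pair_sum (e : I -> I -> nat) (s : seq I) : nat :=
  if s is i :: s' then \sum_(j <- s') e i j + pair_sum e s' else 0.

Lemma leq_pair_sum (e : I -> I -> nat) (r : nat) (s : seq I) : uniq s ->
    (forall i j, i \in s -> j \in s -> i != j -> e i j <= r) ->
  pair_sum e s <= 'C(size s, 2) * r.
Proof.
elim: s => [//|i s IHs] /= /andP[si us] ler.
rewrite binS bin1 mulnDl addnC; apply: leq_add.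
  by apply: IHs => // j k js ks; apply: ler; rewrite inE ?js ?ks orbT.
rewrite -sum1_size big_distrl /= !big_seq; apply: leq_sum => j js.
rewrite mul1n ler ?inE ?eqxx ?js ?orbT //.
by apply: contraNneq si => ->.
Qed.

Lemma double_pair_sum (e : I -> I -> nat) (s : seq I) : uniq s ->
    (forall i j, e i j = e j i) ->
  2 * pair_sum e s = \sum_(i <- s) \sum_(j <- s | j != i) e i j.
Proof.
move=> us esym; elim: s us => [|i s IHs] /=; first by rewrite big_nil.
move=> /andP[si us]; rewrite mulnDr IHs // big_cons big_cons eqxx /=.
have nei j : j \in s -> j != i by move=> js; apply: contraNneq si => <-.
rewrite [X in _ = _ + X](eq_big_seq (fun j => e i j + \sum_(k <- s | k != j) e j k)); last first.
  by move=> j js /=; rewrite big_cons eq_sym (nei _ js) esym.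
rewrite big_split /= [X in _ = X + _]big_seq_cond [X in _ = X + _](eq_bigl (fun j => j \in s)).
  by rewrite -big_seq addnA mul2n addnn.
by move=> j /=; case js: (j \in s) => //=; rewrite nei.
Qed.

End PairSum.

Section CommutingKernels.
Local Open Scope nat_scope.
Variables (F : fieldType) (V : vectType F).
Implicit Types (W Y : {vspace V}) (f g : 'End(V)).

(** Rank-nullity for [g] on the part of [Y] killed by the composition: the image lies in
    [Y :&: lker f]. *)
Lemma dim_cap_lker_comp Y f g : (forall v, v \in Y -> g v \in Y) ->
  \dim (Y :&: lker (f \o g)%VF) <= \dim (Y :&: lker g) + \dim (Y :&: lker f).
Proof.
move=> Yg; rewrite -(limg_ker_dim g); apply: leq_add; apply: dimvS.
  by apply: capvS => //; exact: capvSl.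
apply/subvP => _ /memv_imgP[v + ->]; rewrite !memv_cap !memv_ker comp_lfunE.
by case/andP=> /Yg -> ->.
Qed.

Definition comp_seq (fs : seq 'End(V)) : 'End(V) :=
  foldr (fun f g => (f \o g)%VF) \1%VF fs.

Lemma comp_seq_stable Y fs : (forall f, f \in fs -> forall v, v \in Y -> f v \in Y) ->
  forall v, v \in Y -> comp_seq fs v \in Y.
Proof.
elim: fs => [|f fs IHfs] Yf v Yv /=; first by rewrite id_lfunE.
rewrite comp_lfunE Yf ?mem_head// IHfs// => g gfs; apply: Yf.
by rewrite inE gfs orbT.
Qed.

Lemma dim_cap_lker_comp_seq Y fs :
    (forall f, f \in fs -> forall v, v \in Y -> f v \in Y) ->
  \dim (Y :&: lker (comp_seq fs)) <= \sum_(f <- fs) \dim (Y :&: lker f).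
Proof.
elim: fs => [|f fs IHfs] Yf /=.
  rewrite big_nil leqn0 dimv_eq0; apply/eqP/vspaceP => v.
  rewrite memv_cap memv_ker id_lfunE memv0.
  by case: eqP => [->|]; rewrite ?mem0v ?andbF.
have Yfs g : g \in fs -> forall v, v \in Y -> g v \in Y.
  by move=> gfs; apply: Yf; rewrite inE gfs orbT.
rewrite big_cons addnC; apply: leq_trans (dim_cap_lker_comp _ _) _.
  exact: comp_seq_stable.
by rewrite leq_add2r IHfs.
Qed.

(** The composition of [q] copies of [f] kills [W], so subadditivity of the kernel dimension
    applies. *)
Lemma dim_le_nilpotent (q : nat) W f : (forall v, v \in W -> f v \in W) ->
    (forall v, v \in W -> iter q f v = 0%R) ->
  \dim W <= q * \dim (W :&: lker f).
Proof.
move=> Wf nilf; have eqW : (W :&: lker (comp_seq (nseq q f)))%VS = W.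
  apply/capv_idPl/subvP => v /nilf; rewrite memv_ker => <-.
  by apply/eqP; elim: q {nilf} => [|q /= <-]; rewrite /= ?id_lfunE ?comp_lfunE.
rewrite -{1}eqW; apply: leq_trans (dim_cap_lker_comp_seq _) _.
  by move=> g /nseqP[-> _].
by rewrite big_nseq iter_addn_0 mulnC.
Qed.

Section Family.
Variables (I : eqType) (f : I -> 'End(V)).

Definition commuting_on W := [/\ forall i v, v \in W -> f i v \in W
  & forall i j v, v \in W -> f i (f j v) = f j (f i v)].

Lemma commuting_on_cap W i : commuting_on W -> commuting_on (W :&: lker (f i)).
Proof.
move=> [Wf fC]; split=> [j v|j k v]; last by rewrite memv_cap => /andP[/fC].
rewrite !memv_cap !memv_ker => /andP[Wv /eqP fiv].
by rewrite Wf //= fC // fiv linear0.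
Qed.

Lemma comp_seq_comm W j s v : commuting_on W -> v \in W ->
  f j (comp_seq (map f s) v) = comp_seq (map f s) (f j v).
Proof.
move=> [Wf fC] Wv; elim: s => [|k s IHs] /=; rewrite ?id_lfunE // !comp_lfunE.
rewrite fC ?IHs //; apply: comp_seq_stable Wv => _ /mapP[l _ ->]; exact: Wf.
Qed.

(** By commutation [f j] can be applied first, and it already kills [v]. *)
Lemma comp_seq_map0 W j s v : commuting_on W -> j \in s -> v \in W ->
  f j v = 0%R -> comp_seq (map f s) v = 0%R.
Proof.
move=> comW + Wv fjv; elim: s => [//|k s IHs]; rewrite inE /= comp_lfunE.
case: eqP => [<- _|_ /= /IHs ->]; last exact: linear0.
by rewrite (comp_seq_comm _ _ comW) // fjv linear0.
Qed.

(** The kernels are added one at a time to their sum [U]. A new kernel loses only its intersection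
    with [U], on which the product of the operators already used vanishes. By subadditivity that
    intersection is bounded by the sum of the pairwise ones. *)
Lemma sum_dim_lker W s : commuting_on W ->
  \sum_(i <- s) \dim (W :&: lker (f i)) <=
  \dim W + pair_sum (fun i j => \dim (W :&: lker (f i) :&: lker (f j))) s.
Proof.
move=> comW; have [Wf fC] := comW.
pose U s := (\sum_(i <- s) (W :&: lker (f i)))%VS.
suff H : \sum_(i <- s) \dim (W :&: lker (f i)) <=
    \dim (U s) + pair_sum (fun i j => \dim (W :&: lker (f i) :&: lker (f j))) s.
  apply: leq_trans H _; rewrite leq_add2r dimvS // /U.
  apply: (big_ind (fun X => X <= W)%VS); first exact: sub0v.
    by move=> X Y XW YW; rewrite subv_add XW YW.
  by move=> i _; exact: capvSl.
elim: s => [|i s IHs]; first by rewrite big_nil.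
rewrite big_cons /U big_cons -/(U s) /=.
have := dimv_sum_cap (W :&: lker (f i)) (U s).
suff : \dim (W :&: lker (f i) :&: U s) <=
    \sum_(j <- s) \dim (W :&: lker (f i) :&: lker (f j)) by lia.
have [Wif _] := commuting_on_cap i comW.
apply: leq_trans (_ : _ <= \dim (W :&: lker (f i) :&: lker (comp_seq (map f s)))) _.
  apply/dimvS/capvS => //; rewrite /U big_seq.
  apply: (big_ind (fun X => X <= lker (comp_seq (map f s)))%VS).
  - exact: sub0v.
  - by move=> X Y XW YW; rewrite subv_add XW YW.
  - move=> j js; apply/subvP => v; rewrite memv_cap !memv_ker => /andP[Wv /eqP fjv].
    by rewrite (comp_seq_map0 comW js).
rewrite -(big_map f predT (fun g => \dim (W :&: lker (f i) :&: lker g))).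
by apply: dim_cap_lker_comp_seq => _ /mapP[j _ ->]; exact: Wif.
Qed.

(** [sum_dim_lker] is used twice: on [W], and on each [W :&: lker (f i)] for the remaining indices,
    where the pairwise terms are triple intersections. If S is the left side, the second use bounds
    twice the pair sum of the first by S plus the triple terms, and one S cancels. *)
Lemma lines_ineq W s r : commuting_on W -> uniq s ->
    (forall i j k, i \in s -> j \in s -> k \in s -> i != j -> i != k -> j != k ->
       \dim (W :&: lker (f i) :&: lker (f j) :&: lker (f k)) <= r) ->
  \sum_(i <- s) \dim (W :&: lker (f i)) <=
    2 * \dim W + size s * ('C((size s).-1, 2) * r).
Proof.
move=> comW us ler.
pose e i j := \dim (W :&: lker (f i) :&: lker (f j)).
have H1 := sum_dim_lker s comW.
have esym i j : e i j = e j i by rewrite /e -!capvA [(lker (f i) :&: _)%VS]capvC.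
have H2 := double_pair_sum us esym.
suff H3 : \sum_(i <- s) \sum_(j <- s | j != i) e i j <=
    \sum_(i <- s) \dim (W :&: lker (f i)) + size s * ('C((size s).-1, 2) * r).
  by move: H1 H2 H3; rewrite -/e; lia.
rewrite -[X in _ + X * _]sum1_size big_distrl -big_split /= !big_seq.
apply: leq_sum => i si; rewrite mul1n.
rewrite (_ : \sum_(j <- s | j != i) e i j = \sum_(j <- rem i s) e i j); last first.
  by rewrite rem_filter // big_filter.
apply: leq_trans (sum_dim_lker _ (commuting_on_cap i comW)) _.
rewrite leq_add2l -(size_rem si).
apply: leq_pair_sum; first exact: rem_uniq.
move=> j k; rewrite !mem_rem_uniq // !inE => /andP[ji js] /andP[ki ks] jk.
by apply: ler; rewrite // eq_sym.
Qed.

(* The number s of kernels is the least one with D <= s^2 r. *)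
Lemma cube_ineq W (D r q : nat) (g : nat -> I) : commuting_on W ->
    {in gtn q &, injective g} ->
    (forall i, i < q -> D <= \dim (W :&: lker (f (g i)))) ->
    (forall i j k, i < q -> j < q -> k < q -> i != j -> i != k -> j != k ->
       \dim (W :&: lker (f (g i)) :&: lker (f (g j)) :&: lker (f (g k))) <= r) ->
    D <= q ^ 2 * r ->
  D ^ 3 <= 16 * r * \dim W ^ 2.
Proof.
move=> comW ginj leD ler Dq.
have exs : exists s, D <= s ^ 2 * r by exists q.
pose s := ex_minn exs.
have sq : s <= q by rewrite /s; case: ex_minnP => m _; exact.
have Ds : D <= s ^ 2 * r by rewrite /s; case: ex_minnP.
have sD t : t < s -> t ^ 2 * r < D.
  rewrite /s; case: ex_minnP => m _ mmin tm; rewrite ltnNge.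
  by apply/negP => /mmin; rewrite leqNgt tm.
have [s0|s_gt0] := posnP s; first by move: Ds; rewrite s0 mul0n leqn0 => /eqP ->.
have H := @lines_ineq W (map g (iota 0 s)) r comW.
have {H}H : s * D <= 2 * \dim W + s * ('C(s.-1, 2) * r).
  have {H} := H _ _; rewrite size_map size_iota => H.
  apply: leq_trans (H _ _).
  - rewrite big_map -{1}(size_iota 0 s) -sum1_size big_distrl /= !big_seq.
    apply: leq_sum => i; rewrite mem_iota mul1n => /andP[_ si].
    exact/leD/(leq_trans si).
  - rewrite map_inj_in_uniq ?iota_uniq // => i j; rewrite !mem_iota /= => si sj.
    by apply: ginj; rewrite inE; apply: leq_trans sq.
  - move=> _ _ _ /mapP[i + ->] /mapP[j + ->] /mapP[k + ->].
    rewrite !mem_iota /= => si sj sk gij gik gjk.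
    apply: ler; try exact: leq_trans sq;
      by [apply: contraNneq gij => ->|apply: contraNneq gik => ->|apply: contraNneq gjk => ->].
(* Minimality of [s] gives (s-1)^2 r < D, so the triple terms amount to at most half of s D. *)
have lesD : s * D <= 4 * \dim W.
  have ss : s.-1 < s by rewrite prednK.
  have := sD _ ss; have : 2 * 'C(s.-1, 2) <= s.-1 ^ 2.
    by rewrite mul2n bin2 halfK; nia.
  move: H; nia.
apply: (@leq_trans (D ^ 2 * (s ^ 2 * r))); first by rewrite expnSr leq_mul2l Ds orbT.
rewrite mulnA -expnMn [D * s]mulnC [16 * r]mulnC mulnAC mulnC mulnAC -mulnA leq_mul2l.
have -> : 16 * \dim W ^ 2 = (4 * \dim W) ^ 2 by rewrite expnMn.
by rewrite leq_sqr lesD orbT.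
Qed.

End Family.
End CommutingKernels.

(** * Unipotent operators in characteristic p *)

Section UnipotentChar.
Local Open Scope ring_scope.

Lemma iter_addr_binomial (U : zmodType) (f : {additive U -> U}) m v :
  iter m (fun w => f w + w) v = \sum_(i < m.+1) iter i f v *+ 'C(m, i).
Proof.
elim: m => [|m IHm]; first by rewrite big_ord1.
rewrite iterS IHm raddf_sum -big_split /=.
rewrite (eq_bigr (fun i : 'I_m.+1 => iter i.+1 f v *+ 'C(m, i) + iter i f v *+ 'C(m, i)));
  last by move=> i _; rewrite raddfMn.
rewrite big_split /= [X in _ + X]big_ord_recl [RHS]big_ord_recl !bin0 /=.
rewrite addrCA; congr (_ + _).
under [RHS]eq_bigr => i _ do rewrite /bump /= add1n binS mulrnDr.
rewrite big_split /= addrC; congr (_ + _).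
by rewrite [RHS]big_ord_recr /= bin_small // mulr0n addr0.
Qed.

(** In characteristic p the binomial theorem reads (1 + f)^p = 1 + f^p, since p divides the middle
    coefficients. *)
Lemma iter_unipotent0 (p : nat) (U : lmodType 'F_p) (f : {additive U -> U}) v :
  prime p -> iter p (fun w => f w + w) v = v -> iter p f v = 0.
Proof.
move=> hp; have p_gt0 := prime_gt0 hp.
rewrite iter_addr_binomial big_ord_recr (bigD1 (Ordinal p_gt0)) //= bin0 binn.
rewrite big1 => [|i i0]; first by rewrite addr0 -[RHS](addr0 v) => /addrI.
have pU (w : U) : w *+ p = 0 by rewrite -scaler_nat pchar_Fp_0 ?scale0r.
have /dvdnP[q ->] : (p %| 'C(p, i))%N.
  by rewrite prime_dvd_bin // ltn_ord andbT lt0n.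
by rewrite mulrnA pU.
Qed.

End UnipotentChar.

Local Open Scope ring_scope.

(** * The recursion *)

Section Recursion.
Variable R : realType.

(** For a fixed c, [D k j] is the dimension attached to H(c, k, j), whose index in G is p to the
    power N0 (j-1) + (k-1). The exponent k + 2j of [mu] equals 3j on the diagonal k = j, where the
    base bound is theta^j <= mu^(3j), and it is preserved by the cubic step. At k = 1 it leaves
    about mu^(2j), whence the factor 2/3. The induction is on s = j - k. *)
Lemma recursion_stage (C theta mu : R) (p N0 n0 : nat) (D : nat -> nat -> nat) :
    0 < C -> 0 < theta -> 0 < mu -> theta <= mu ^+ 3 -> (0 < p)%N -> (2 <= N0)%N ->
    (forall k j, (0 < k <= j)%N -> (j <= n0)%N ->
       (D k j)%:R <= C * theta ^+ j * p%:R ^+ (N0.+1 * j.-1)) ->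
    (forall k j, 0 < k < j -> j < n0 ->
       D k j.+1 ^ 3 <= 16 * (p ^ (N0 - 2) * D k j) * D k.+1 j.+1 ^ 2)%N ->
  forall s k, (0 < k)%N -> (k + s <= n0)%N ->
    (D k (k + s)%N)%:R <= C * p%:R * (1 + mu) * mu ^+ (k + 2 * (k + s)) * 10 ^+ s
      * p%:R ^+ (N0 * (k + s).-1 + k.-1).
Proof.
have ex1 (k j : nat) : (k + 2 * j + (k.+1 + 2 * j.+1) * 2 = (k + 2 * j.+1) * 3)%N by lia.
have ex2 (N k j : nat) : (1 < N)%N -> (0 < k)%N -> (0 < j)%N ->
    (N - 2 + (N * j.-1 + k.-1) + (N * j + k) * 2 = (N * j + k.-1) * 3)%N.
  case: k j => // k [] // j N2 _ _ /=; by rewrite (mulnS N j); move: (N * j)%N => Z; lia.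
move=> C0 th0 mu0 thmu p0 N2 base step.
have P1 : 1 <= p%:R :> R by rewrite ler1n.
have P0 : 0 < p%:R :> R by rewrite ltr0n.
have baseE k j : (0 < k <= j)%N -> (j <= n0)%N ->
    (D k j)%:R <= C * mu ^+ (3 * j) * p%:R ^+ (N0.+1 * j.-1).
  move=> kj jn; apply: le_trans (base k j kj jn) _; rewrite ler_wpM2r ?exprn_ge0 //.
  by rewrite ler_wpM2l ?(ltW C0) // exprM lerXn2r ?nnegrE ?(ltW th0) // exprn_ge0 // ltW.
have pos a b c : 0 <= C * p%:R * (1 + mu) * mu ^+ a * 10 ^+ b * p%:R ^+ c.
  by rewrite ltW // !mulr_gt0 ?exprn_gt0 ?addr_gt0.
elim=> [|s IHs] k k0 ksn.
  rewrite addn0 in ksn *; apply: le_trans (baseE k k _ ksn) _; first by rewrite k0 leqnn.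
  rewrite expr0 mulr1 (_ : N0 * k.-1 + k.-1 = N0.+1 * k.-1)%N; last by rewrite mulSn addnC.
  rewrite ler_wpM2r ?exprn_ge0 // (_ : k + 2 * k = 3 * k)%N; last by rewrite mulSn.
  rewrite ler_wpM2r ?exprn_ge0 ?(ltW mu0) // -mulrA ler_peMr ?(ltW C0) //.
  by apply: mulr_ege1 => //; rewrite lerDl ltW.
(* The cubic step needs k < j, so s = 1 is also taken from the base bound; the extra factor p mu is
   absorbed by p (1 + mu). *)
case: s IHs ksn => [_|s IHs] ksn.
  apply: le_trans (baseE k (k + 1)%N _ ksn) _; first by rewrite k0 leq_addr.
  have -> : (3 * (k + 1) = k + 2 * (k + 1) + 1)%N by lia.
  have -> : (N0.+1 * (k + 1).-1 = (N0 * (k + 1).-1 + k.-1) + 1)%N by lia.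
  rewrite [mu ^+ (_ + 1)]exprD [p%:R ^+ (_ + 1)]exprD !expr1.
  set X := mu ^+ _; set Y := p%:R ^+ _.
  have X0 : 0 < X by rewrite exprn_gt0.
  have Y0 : 0 < Y by rewrite exprn_gt0.
  have -> : C * (X * mu) * (Y * p%:R) = (C * p%:R * X * Y) * mu by ring.
  have -> : C * p%:R * (1 + mu) * X * 10 * Y = (C * p%:R * X * Y) * (10 * (1 + mu)) by ring.
  by rewrite ler_wpM2l ?mulr_ge0 ?(ltW C0) ?(ltW X0) ?(ltW Y0) ?(ltW P0) //; lra.
have e1 : (k + s.+2 = (k + s.+1).+1)%N by rewrite addnS.
have H : (D k (k + s.+2) ^ 3 <=
    16 * (p ^ (N0 - 2) * D k (k + s.+1)) * D k.+1 (k + s.+2) ^ 2)%N.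
  have kj : (0 < k < k + s.+1)%N by rewrite k0 addnS ltnS leq_addr.
  have jn : (k + s.+1 < n0)%N by rewrite -e1.
  by rewrite e1; exact: (step _ _ kj jn).
have I1 := IHs k k0 (leq_trans (leq_add (leqnn k) (leqnSn _)) ksn).
have I2 := IHs k.+1 isT; rewrite [(k.+1 + s.+1)%N]addSnnS in I2; have {}I2 := I2 ksn.
rewrite -(@ler_pXn2r _ 3) ?nnegrE ?ler0n //.
apply: (@le_trans _ _ (16 * (p%:R ^+ (N0 - 2) * (D k (k + s.+1)%N)%:R) * (D k.+1 (k + s.+2)%N)%:R ^+ 2)).
  by rewrite -!natrX -!natrM ler_nat.
move: I1 I2; set a := (D _ _)%:R; set b := (D k.+1 _)%:R; set A := (X in a <= X); set B := (X in b <= X).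
move=> aA bB.
have a0 : 0 <= a by rewrite ler0n.
have b0 : 0 <= b by rewrite ler0n.
apply: (@le_trans _ _ (16 * (p%:R ^+ (N0 - 2) * A) * B ^+ 2)).
  apply: ler_pM; rewrite ?mulr_ge0 ?exprn_ge0 //.
    by rewrite ler_wpM2l // ler_wpM2l ?exprn_ge0.
  by rewrite lerXn2r ?nnegrE // (le_trans b0).
rewrite /A /B; set E := C * p%:R * (1 + mu).
set j := (k + s.+1)%N; have -> : (k + s.+2 = j.+1)%N by rewrite /j !addnS.
have E0 : 0 < E by rewrite !mulr_gt0 // addr_gt0.
have -> : 16 * (p%:R ^+ (N0 - 2) * (E * mu ^+ (k + 2 * j) * 10 ^+ s.+1 * p%:R ^+ (N0 * j.-1 + k.-1))) *
   (E * mu ^+ (k.+1 + 2 * j.+1) * 10 ^+ s.+1 * p%:R ^+ (N0 * j.+1.-1 + k.+1.-1)) ^+ 2 =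
  16 * (E ^+ 3 * (mu ^+ (k + 2 * j) * mu ^+ (k.+1 + 2 * j.+1) ^+ 2) * (10 ^+ s.+1) ^+ 3 *
  (p%:R ^+ (N0 - 2) * p%:R ^+ (N0 * j.-1 + k.-1) * p%:R ^+ (N0 * j.+1.-1 + k.+1.-1) ^+ 2)) by ring.
have -> : mu ^+ (k + 2 * j) * mu ^+ (k.+1 + 2 * j.+1) ^+ 2 = mu ^+ (k + 2 * j.+1) ^+ 3.
  by rewrite -!exprM -exprD ex1.
have -> : p%:R ^+ (N0 - 2) * p%:R ^+ (N0 * j.-1 + k.-1) * p%:R ^+ (N0 * j.+1.-1 + k.+1.-1) ^+ 2
   = p%:R ^+ (N0 * j.+1.-1 + k.-1) ^+ 3 :> R.
  by rewrite -!exprM -!exprD /= ex2 // /j addnS.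
(* The cube of the new factor 10 has to dominate the constant 16. *)
have -> : (E * mu ^+ (k + 2 * j.+1) * 10 ^+ s.+2 * p%:R ^+ (N0 * j.+1.-1 + k.-1)) ^+ 3 =
  10 ^+ 3 * (E ^+ 3 * mu ^+ (k + 2 * j.+1) ^+ 3 * (10 ^+ s.+1) ^+ 3 * p%:R ^+ (N0 * j.+1.-1 + k.-1) ^+ 3).
  by rewrite [10 ^+ s.+2]exprS; ring.
have Zpos a' b' c' : 0 <= E ^+ 3 * mu ^+ a' ^+ 3 * (10 ^+ b') ^+ 3 * p%:R ^+ c' ^+ 3.
  by rewrite -!exprMn; apply: exprn_ge0; exact: pos.
apply: ler_wpM2r; first exact: Zpos.
by rewrite -natrX ler_nat.
Qed.

(** The growth factor per level of the normalised dimension after [m] descents in c. At [m = 0] it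
    is the saving 1/p of the hypothesis on L. *)
Definition rate (p m : nat) : R := 10 ^+ m * p%:R `^ (- (2 / 3) ^+ m).

Lemma rate_gt0 p m : (0 < p)%N -> 0 < rate p m.
Proof. by move=> p0; rewrite mulr_gt0 ?exprn_gt0 ?powR_gt0 ?ltr0n. Qed.

Lemma rate_cube_root p m : (0 < p)%N ->
  exists mu : R, [/\ 0 < mu, rate p m <= mu ^+ 3 & 10 * mu ^+ 2 = rate p m.+1].
Proof.
move=> p0; have P0 : 0 < p%:R :> R by rewrite ltr0n.
set q : R := p%:R `^ (- (2 / 3) ^+ m / 3).
have q0 : 0 < q by rewrite powR_gt0.
have qE k : q ^+ k = p%:R `^ (- (2 / 3) ^+ m / 3 * k%:R).
  by rewrite -powR_mulrn ?(ltW q0) // -powRrM.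
have b0 : 1 <= Num.sqrt (10 ^+ m : R).
  by rewrite -[leLHS]sqrtr1; apply: ler_wsqrtr; apply: exprn_ege1; rewrite ler1n.
have bgt0 : 0 < Num.sqrt (10 ^+ m : R) by apply: lt_le_trans b0.
have bE : Num.sqrt (10 ^+ m : R) ^+ 2 = 10 ^+ m by rewrite sqr_sqrtr // exprn_ge0.
(* The square root makes 10 mu^2 exact; being at least 1, it leaves room in the inequality for
   mu^3. *)
exists (Num.sqrt (10 ^+ m) * q); split; first exact: mulr_gt0.
  rewrite exprMn exprS bE qE /rate divfK ?pnatr_eq0 //.
  by rewrite ler_wpM2r ?powR_ge0 // ler_peMl // exprn_ge0.
rewrite exprMn bE qE /rate exprS mulrA; congr (_ * p%:R `^ _).
by rewrite exprS; field.
Qed.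

(** [C'] is chosen before [n0] and [D], because the dimensions will come from a finite model that
    changes with n. The proof descends from c = d to c = 1, by induction on m = d - c. *)
Lemma recursion_bound (d p : nat) (C : R) : (2 <= d)%N -> (0 < p)%N -> 0 < C ->
  exists2 C' : R, 0 < C' & forall (n0 : nat) (D : nat -> nat -> nat -> nat),
    (forall j, (0 < j <= n0)%N ->
       (D d 1%N j)%:R <= C * p%:R ^- j * p%:R ^+ ((d * d - 1) * j.-1)) ->
    (forall c k j, 0 < c < d -> 0 < k <= j -> j <= n0 -> D c k j <= D c.+1 1 j)%N ->
    (forall c k j, 0 < c < d -> 0 < k < j -> j < n0 ->
       D c k j.+1 ^ 3 <= 16 * (p ^ (d * d - d + c - 3) * D c k j) * D c k.+1 j.+1 ^ 2)%N ->
  forall j, (0 < j <= n0)%N ->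
    (D 1%N 1%N j)%:R <= C' * rate p d.-1 ^+ j * p%:R ^+ ((d * d - d) * j.-1).
Proof.
move=> d2 p0 C0; have P0 : 0 < p%:R :> R by rewrite ltr0n.
suff H m : (m < d)%N -> exists2 C' : R, 0 < C' & forall (n0 : nat) (D : nat -> nat -> nat -> nat),
    (forall j, (0 < j <= n0)%N ->
       (D d 1%N j)%:R <= C * p%:R ^- j * p%:R ^+ ((d * d - 1) * j.-1)) ->
    (forall c k j, 0 < c < d -> 0 < k <= j -> j <= n0 -> D c k j <= D c.+1 1 j)%N ->
    (forall c k j, 0 < c < d -> 0 < k < j -> j < n0 ->
       D c k j.+1 ^ 3 <= 16 * (p ^ (d * d - d + c - 3) * D c k j) * D c k.+1 j.+1 ^ 2)%N ->
  forall j, (0 < j <= n0)%N ->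
    (D (d - m)%N 1%N j)%:R <= C' * rate p m ^+ j * p%:R ^+ ((d * d - m.+1) * j.-1).
  have [|C' C'0 HC] := H d.-1; first by rewrite prednK // ltnW.
  exists C' => // n0 D H0 H1 H2 j jn; have := HC n0 D H0 H1 H2 j jn.
  by rewrite prednK ?(ltnW d2) // (_ : d - d.-1 = 1)%N //; lia.
elim: m => [_|m IHm md].
  exists C => // n0 D H0 _ _ j jn; rewrite subn0; apply: le_trans (H0 j jn) _.
  by rewrite /rate expr0 mul1r powR_inv1 ?(ltW P0) // exprVn.
have [C1 C10 HC1] := IHm (ltnW md).
have [mu [mu0 thmu muE]] := rate_cube_root m p0.
have [c [cE dmE]] : exists c, (d - m.+1 = c /\ d - m = c.+1)%N.
  by exists (d - m.+1)%N; split=> //; lia.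
have c0 : (0 < c < d)%N by lia.
pose N0 := (d * d - m.+2)%N.
have d2le : (d + d <= d * d)%N by nia.
have N0E : (d * d - m.+1 = N0.+1)%N by rewrite /N0; lia.
(* This is the prefactor of [recursion_stage] at k = 1, together with the odd factor of mu^(1 +
   2j). *)
exists (C1 * p%:R * (1 + mu) * mu); first by rewrite !mulr_gt0 // addr_gt0.
move=> n0 D H0 H1 H2 j /andP[j0 jn].
have H := @recursion_stage C1 (rate p m) mu p N0 n0 (D c) C10 (rate_gt0 m p0) mu0 thmu p0.
have {}H := H _ _ _ j.-1 1%N isT; rewrite add1n prednK // in H.
rewrite cE; apply: le_trans (H _ _ _ jn) _.
- by rewrite /N0; lia.
- move=> k i ki lin; apply: le_trans (_ : (D c.+1 1%N i)%:R <= _); first by rewrite ler_nat H1.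
  by rewrite -dmE -N0E; apply: (HC1 n0) => //; lia.
- move=> k i ki lin; have := H2 c k i c0 ki lin.
  by have -> : (d * d - d + c - 3 = N0 - 2)%N by rewrite /N0; lia.
rewrite addn0 ler_wpM2r ?exprn_ge0 // -muE exprMn -exprM.
rewrite add1n exprS -!mulrA ler_wpM2l ?(ltW C10) // ler_wpM2l //.
rewrite ler_wpM2l ?addr_ge0 ?(ltW mu0) // ler_wpM2l ?(ltW mu0) //.
rewrite mulrC ler_wpM2r ?exprn_ge0 ?(ltW mu0) //.
by rewrite ler_weXn2l ?ler1n // leq_pred.
Qed.

End Recursion.

Local Open Scope classical_set_scope.
Local Open Scope ring_scope.

(** * p-adic integers *)

Section PadicDivisibility.
Variables (p : nat) (hp : prime p).
Implicit Types x y z : padic_int p.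

Lemma padic_base_prime : padic_base p = p.
Proof. by rewrite /padic_base Zp_cast // prime_gt1. Qed.

Lemma padic_resD x y n : (x + y) n = ((x n + y n) %% p ^ n)%N.
Proof. by have -> : (x + y) n = ((x n + y n) %% padic_base p ^ n)%N by []; rewrite padic_base_prime. Qed.

Lemma padic_resM x y n : (x * y) n = ((x n * y n) %% p ^ n)%N.
Proof. by have -> : (x * y) n = ((x n * y n) %% padic_base p ^ n)%N by []; rewrite padic_base_prime. Qed.

Lemma padic_res_mod x n : (x n %% p ^ n)%N = x n.
Proof. by have := padic_mod x n; rewrite padic_base_prime. Qed.

Lemma padic_res_lt x n : (x n < p ^ n)%N.
Proof. by have := padic_lt x n; rewrite padic_base_prime. Qed.

Lemma padic_res_modS x n m : (n <= m)%N -> (x m %% p ^ n)%N = x n.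
Proof.
move=> /subnK <-; elim: (m - n)%N => [|k IHk]; first exact: padic_res_mod.
have := padic_resP x (k + n); rewrite padic_base_prime => xk.
by rewrite addSn -IHk -xk modn_dvdm // dvdn_exp2l // leq_addl.
Qed.

Lemma padic_res0 n : (0 : padic_int p) n = 0%N.
Proof. by rewrite /= mod0n. Qed.

Lemma padic_res_natr k n : (k%:R : padic_int p) n = (k %% p ^ n)%N.
Proof.
elim: k => [|k IHk]; first by rewrite padic_res0 mod0n.
rewrite -addn1 natrD padic_resD IHk [(1%:R : padic_int p) n]/=.
by rewrite padic_base_prime modnDm.
Qed.

Definition pdvd n x := exists z, x = p%:R ^+ n * z.

Lemma padic_res_pX n m z : (p%:R ^+ n * z) (m + n)%N = (p ^ n * z m)%N.
Proof.
rewrite -natrX padic_resM padic_res_natr modnMml addnC expnD -muln_modr.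
by rewrite padic_res_modS // leq_addl.
Qed.

Lemma pX_inj n x y : p%:R ^+ n * x = p%:R ^+ n * y -> x = y.
Proof.
move=> e; apply: padic_eq => m.
have : (p%:R ^+ n * x) (m + n)%N = (p%:R ^+ n * y) (m + n)%N by rewrite e.
rewrite !padic_res_pX => /eqP; rewrite eqn_pmul2l ?expn_gt0 ?prime_gt0 //.
by move/eqP.
Qed.

(** Division by p^n shifts the precision: the quotient modulo p^m is read off from [x] modulo
    p^(m+n). *)
Fact padic_quo_subproof n x m :
  ((x (m.+1 + n) %/ p ^ n) %% padic_base p ^ m = x (m + n) %/ p ^ n)%N.
Proof.
rewrite padic_base_prime -(@padic_res_modS x (m + n) (m.+1 + n)) ?leq_add2r //.
by rewrite addnC expnD modn_divl mulnC.
Qed.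
Definition padic_quo n x := PadicInt (padic_quo_subproof n x).

Lemma pdvdP n x : pdvd n x <-> x n = 0%N.
Proof.
split=> [[z ->]|xn0].
  by rewrite -[X in padic_res _ X]add0n padic_res_pX [z 0%N](_ : _ = 0%N) ?muln0 //;
     have := padic_res_lt z 0; case: (z 0%N).
exists (padic_quo n x); apply: padic_eq => m.
have := @padic_res_pX n m (padic_quo n x).
rewrite -(@padic_res_modS (p%:R ^+ n * padic_quo n x) m (m + n)) ?leq_addr // => ->.
rewrite -(@padic_res_modS x m (m + n)) ?leq_addr //; congr (_ %% _)%N.
rewrite mulnC divnK // /dvdn; apply/eqP.
by rewrite padic_res_modS // leq_addl.
Qed.

Lemma padic_res_eq n x y : x n = y n <-> pdvd n (x - y).
Proof.
rewrite pdvdP; have := padic_resD y (x - y) n; rewrite addrC subrK => e.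
split=> [xy|xy0]; last by rewrite e xy0 addn0 padic_res_mod.
have : (y n + (x - y)%R n == y n + 0 %[mod p ^ n])%N.
  by rewrite -e addn0 padic_res_mod xy.
by rewrite eqn_modDl mod0n padic_res_mod => /eqP.
Qed.

Lemma pdvd0 n : pdvd n 0. Proof. by exists 0; rewrite mulr0. Qed.

Lemma pdvd_n0 x : pdvd 0 x. Proof. by exists x; rewrite mul1r. Qed.

Lemma pdvdD n x y : pdvd n x -> pdvd n y -> pdvd n (x + y).
Proof. by move=> [a ->] [b ->]; exists (a + b); rewrite mulrDr. Qed.

Lemma pdvdN n x : pdvd n x -> pdvd n (- x).
Proof. by move=> [a ->]; exists (- a); rewrite mulrN. Qed.

Lemma pdvdB n x y : pdvd n x -> pdvd n y -> pdvd n (x - y).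
Proof. by move=> xn yn; apply/pdvdD/pdvdN. Qed.

Lemma pdvdMl n x y : pdvd n y -> pdvd n (x * y).
Proof. by move=> [a ->]; exists (x * a); rewrite mulrCA. Qed.

Lemma pdvdMr n x y : pdvd n x -> pdvd n (x * y).
Proof. by move=> ?; rewrite mulrC; exact: pdvdMl. Qed.

Lemma pdvd_le m n x : (m <= n)%N -> pdvd n x -> pdvd m x.
Proof.
by move=> mn [a ->]; exists (p%:R ^+ (n - m) * a); rewrite mulrA -exprD subnKC.
Qed.

Lemma pdvdM m n x y : pdvd m x -> pdvd n y -> pdvd (m + n) (x * y).
Proof. by move=> [a ->] [b ->]; exists (a * b); rewrite exprD; ring. Qed.

Lemma pdvd_pX n : pdvd n (p%:R ^+ n). Proof. by exists 1; rewrite mulr1. Qed.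

Lemma pdvd_sum n (I : Type) (r : seq I) (P : pred I) (E : I -> padic_int p) :
  (forall i, P i -> pdvd n (E i)) -> pdvd n (\sum_(i <- r | P i) E i).
Proof. by move=> H; apply: big_ind => //; [exact: pdvd0|exact: pdvdD]. Qed.

Lemma pdvd_prod1 n (I : Type) (r : seq I) (E : I -> padic_int p) :
  (forall i, pdvd n (E i - 1)) -> pdvd n (\prod_(i <- r) E i - 1).
Proof.
move=> H; apply: (big_ind (fun x => pdvd n (x - 1))) => [|x y x1 y1|i _] //.
  by rewrite subrr; exact: pdvd0.
have -> : x * y - 1 = x * (y - 1) + (x - 1) by ring.
by apply: pdvdD => //; exact: pdvdMl.
Qed.

Definition padic_red x : 'F_p := (x 1%N)%:R.

Lemma padic_redD x y : padic_red (x + y) = padic_red x + padic_red y.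
Proof. by rewrite /padic_red padic_resD expn1 Fp_nat_mod // natrD. Qed.

Lemma padic_redM x y : padic_red (x * y) = padic_red x * padic_red y.
Proof. by rewrite /padic_red padic_resM expn1 Fp_nat_mod // natrM. Qed.

Lemma padic_red_natr k : padic_red k%:R = k%:R.
Proof. by rewrite /padic_red padic_res_natr expn1 Fp_nat_mod. Qed.

Lemma padic_redN x : padic_red (- x) = - padic_red x.
Proof.
by apply/eqP; rewrite -addr_eq0 -padic_redD addNr (padic_red_natr 0).
Qed.

Lemma Fp_natr_eq0 k : ((k%:R : 'F_p) == 0) = (p %| k)%N.
Proof. by rewrite (dvdn_pcharf (pchar_Fp hp)). Qed.

Lemma padic_red_eq0 x : padic_red x = 0 <-> pdvd 1 x.
Proof.
rewrite pdvdP /padic_red; split=> [/eqP|->//].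
by rewrite Fp_natr_eq0 => /eqP; have := padic_res_mod x 1; rewrite expn1 => ->.
Qed.

(** On multiples of p^n this induces the isomorphism of p^n Z_p / p^(n+1) Z_p with F_p; see [digitD]
    and [digit_eq0]. *)
Definition digit n x : 'F_p := (x n.+1 %/ p ^ n)%:R.

Lemma digit_pX n z : digit n (p%:R ^+ n * z) = padic_red z.
Proof.
by rewrite /digit -[n.+1]/(1 + n)%N padic_res_pX mulKn // expn_gt0 prime_gt0.
Qed.

Lemma digitD n x y : pdvd n x -> pdvd n y -> digit n (x + y) = digit n x + digit n y.
Proof. by move=> [a ->] [b ->]; rewrite -mulrDr !digit_pX padic_redD. Qed.

Lemma digit_eq0 n x : pdvd n x -> digit n x = 0 <-> pdvd n.+1 x.
Proof.
move=> [a ->]; rewrite digit_pX padic_red_eq0; split=> [[b ->]|[b]].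
  by exists b; rewrite expr1 exprSr mulrA.
by rewrite exprSr -mulrA => /pX_inj ->; exists b; rewrite expr1.
Qed.

Lemma digit0 n : digit n 0 = 0.
Proof. by rewrite -(mulr0 (p%:R ^+ n)) digit_pX (padic_red_natr 0). Qed.

Lemma digit_eq n x y : pdvd n x -> pdvd n.+1 (x - y) -> digit n x = digit n y.
Proof.
move=> xn xy; have yn : pdvd n y.
  by rewrite -[y](subKr x); apply: pdvdB => //; apply: pdvd_le xy.
rewrite -[x](subrK y) addrC digitD //; last exact: pdvd_le xy.
by have [_ ->] := digit_eq0 (pdvd_le (leqnSn n) xy); rewrite ?addr0.
Qed.

Definition geom (a : padic_int p) n := \sum_(k < n) a ^+ k.

Fact padic_geom_subproof a (ha : pdvd 1 a) n :
  (geom a n.+1 n.+1 %% padic_base p ^ n = geom a n n)%N.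
Proof.
rewrite padic_base_prime padic_res_modS //; apply/padic_res_eq.
rewrite /geom big_ord_recr /= addrAC subrr add0r.
by case: ha => b ->; exists (b ^+ n); rewrite expr1 exprMn.
Qed.

(* The inverse of 1 - a is the limit of the partial geometric sums. *)
Lemma padic_inv x : pdvd 1 (x - 1) -> exists2 y, x * y = 1 & pdvd 1 (y - 1).
Proof.
move=> x1; have ha : pdvd 1 (1 - x) by rewrite -opprB; exact: pdvdN.
pose y := PadicInt (padic_geom_subproof ha).
have yE n : y n = geom (1 - x) n n by [].
have xy : x * y = 1.
  apply: padic_eq => n; rewrite padic_resM yE -padic_resM.
  apply/padic_res_eq; have -> : x * geom (1 - x) n - 1 = - (1 - x) ^+ n.
    have := subrX1 (1 - x) n; rewrite -/(geom _ _) => e.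
    have -> : x * geom (1 - x) n = - ((1 - x - 1) * geom (1 - x) n) by ring.
    by rewrite -e; ring.
  apply: pdvdN; have [b ->] := ha; exists (b ^+ n).
  by rewrite expr1 exprMn.
exists y => //; have -> : y - 1 = - (x - 1) * y by rewrite mulNr mulrBl xy; ring.
exact/pdvdMr/pdvdN.
Qed.

End PadicDivisibility.

(** * Congruence subgroups *)

Section MatrixCongruence.
Variables (p d : nat) (hp : prime p).
Local Notation M := 'M[padic_int p]_d.
Implicit Types (A B : M) (g h x y : M).

Definition mxcong n A B := forall i j, pdvd n (A i j - B i j).

Lemma congr_modP n A B : congr_mod n A B <-> mxcong n A B.
Proof.
split=> [[X e] i j|H].
  by exists (X i j); have := congr1 (fun C : M => C i j) e; rewrite !mxE.
exists (\matrix_(i, j) sval (cid (H i j))); apply/matrixP => i j.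
by rewrite !mxE; case: (cid _).
Qed.

Lemma mxcong_refl n A : mxcong n A A.
Proof. by move=> i j; rewrite subrr; exact: pdvd0. Qed.

Lemma mxcong_sym n A B : mxcong n A B -> mxcong n B A.
Proof. by move=> AB i j; rewrite -opprB; exact/pdvdN/AB. Qed.

Lemma mxcong_trans n A B C : mxcong n A B -> mxcong n B C -> mxcong n A C.
Proof.
by move=> AB BC i j; rewrite -(subrK (B i j) (A i j)) -addrA; exact: pdvdD.
Qed.

Lemma mxcong_le m n A B : (m <= n)%N -> mxcong n A B -> mxcong m A B.
Proof. by move=> mn AB i j; exact: pdvd_le (AB i j). Qed.

Lemma mxcongM n A A' B B' :
  mxcong n A A' -> mxcong n B B' -> mxcong n (A *m B) (A' *m B').
Proof.
move=> AA BB i j; rewrite !mxE -sumrB; apply: pdvd_sum => k _.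
have -> : A i k * B k j - A' i k * B' k j =
  (A i k - A' i k) * B k j + A' i k * (B k j - B' k j) by ring.
by apply: pdvdD; [exact: pdvdMr|exact: pdvdMl].
Qed.

Lemma GnP n g : Gn n g <-> \det g = 1 /\ mxcong n g 1%:M.
Proof. by rewrite /Gn /SLd /= congr_modP. Qed.

Lemma Gn_le m n g : (m <= n)%N -> Gn n g -> Gn m g.
Proof. by move=> mn /GnP[g1 gn]; apply/GnP; split=> //; exact: mxcong_le gn. Qed.

Lemma Gn1 n : @Gn p d n 1%:M.
Proof. by apply/GnP; split; [exact: det1|exact: mxcong_refl]. Qed.

Lemma GnM n g h : Gn n g -> Gn n h -> Gn n (g *m h).
Proof.
move=> /GnP[g1 gn] /GnP[h1 hn]; apply/GnP; split; first by rewrite det_mulmx g1 h1 mulr1.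
by rewrite -(mul1mx 1%:M); exact: mxcongM.
Qed.

(** Adjugates serve as inverses in SL_d, over any commutative ring. *)
Lemma SL_adjK g : \det g = 1 -> g *m \adj g = 1%:M /\ \adj g *m g = 1%:M.
Proof. by move=> g1; rewrite mul_mx_adj mul_adj_mx g1. Qed.

Lemma det_adj1 g : \det g = 1 -> \det (\adj g) = 1.
Proof.
move=> g1; have [e _] := SL_adjK g1.
by have := congr1 determinant e; rewrite det_mulmx g1 mul1r det1.
Qed.

Lemma mxcong_adj n x y : \det y = 1 -> mxcong n x y -> mxcong n (\adj y *m x) 1%:M.
Proof.
by move=> y1 xy; rewrite -(SL_adjK y1).2; apply: mxcongM => //; exact: mxcong_refl.
Qed.

Lemma Gn_adj n g : Gn n g -> Gn n (\adj g).
Proof.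
move=> /GnP[g1 gn]; apply/GnP; split; first exact: det_adj1.
by rewrite -(mulmx1 (\adj g)); apply/mxcong_adj/mxcong_sym.
Qed.

(** Turns congruences modulo p^n into equations in the group, with z = y^-1 x. *)
Lemma mxcong_coset n x y : \det x = 1 -> \det y = 1 -> mxcong n x y ->
  exists2 z, Gn n z & x = y *m z.
Proof.
move=> x1 y1 xy; exists (\adj y *m x); last first.
  by rewrite mulmxA (SL_adjK y1).1 mul1mx.
apply/GnP; split; last exact: mxcong_adj.
by rewrite det_mulmx det_adj1 // x1 mulr1.
Qed.

Lemma G1_entry g i j : G1 g -> pdvd 1 (g i j - (i == j)%:R).
Proof. by move=> /GnP[_ /(_ i j)]; rewrite mxE. Qed.

Definition elem_mx (a b : 'I_d) (z : padic_int p) : M := 1%:M + z *: delta_mx a b.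

Lemma elem_mxE a b z i j :
  elem_mx a b z i j = (i == j)%:R + z * ((i == a) && (j == b))%:R.
Proof. by rewrite !mxE. Qed.

Lemma elem_mulmxE a b z A i j :
  (elem_mx a b z *m A) i j = A i j + (i == a)%:R * (z * A b j).
Proof.
rewrite mulmxDl mul1mx -scalemxAl !mxE; congr (_ + _).
rewrite (bigD1 b) //= mxE eqxx andbT big1 ?addr0; first by ring.
by move=> k /negPf kb; rewrite mxE kb andbF mul0r.
Qed.

Lemma mulmx_elemE a b z A i j :
  (A *m elem_mx a b z) i j = A i j + (j == b)%:R * (z * A i a).
Proof.
rewrite mulmxDr mulmx1 -scalemxAr !mxE; congr (_ + _).
rewrite (bigD1 a) //= mxE eqxx big1 ?addr0; first by ring.
by move=> k /negPf kb; rewrite mxE kb mulr0.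
Qed.

Lemma det_elem_mx a b z : a != b -> \det (elem_mx a b z) = 1.
Proof.
have lower (a' b' : 'I_d) : (b' < a')%N -> \det (elem_mx a' b' z) = 1.
  move=> ba; rewrite det_trig; last first.
    apply/is_trig_mxP => i j ij; rewrite elem_mxE.
    have -> : (i == j) = false by apply: contraTF ij => /eqP ->; rewrite ltnn.
    case: eqP => [ia|]; last by rewrite mulr0 addr0.
    by case: eqP => [jb|]; [move: ij; rewrite ia jb; lia|rewrite mulr0 addr0].
  apply: big1 => i _; rewrite elem_mxE eqxx.
  case: eqP => [ia|_]; case: eqP => [ib|_]; rewrite ?mulr0 ?addr0 //.
  by move: ba; rewrite -ia -ib ltnn.
move=> ab; have [ba|] := ltnP b a; first exact: lower.
rewrite leq_eqVlt => /orP[/eqP e|lab]; first by rewrite (val_inj e) eqxx in ab.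
rewrite -det_tr -(lower b a lab); congr (\det _); apply/matrixP => i j.
by rewrite mxE !elem_mxE eq_sym andbC.
Qed.

Lemma Gn_elem n a b z : a != b -> pdvd n z -> Gn n (elem_mx a b z).
Proof.
move=> ab zn; apply/GnP; split; first exact: det_elem_mx.
by move=> i j; rewrite elem_mxE mxE addrAC subrr add0r; exact: pdvdMr.
Qed.

End MatrixCongruence.

(** * The groups H(c, k, n) and the coordinates of their quotients *)

Section CongruencePatterns.
Variables (p d : nat) (hp : prime p) (i0 : 'I_d).
Local Notation M := 'M[padic_int p]_d.
Implicit Types (g h x y : M) (a b : 'I_d).

Definition level (c k n : nat) a b : nat :=
  if a != b then n else if (a < c)%N then n else if a == c :> nat then k else 0.

Definition deviation g a b : padic_int p := g a b - g i0 i0 *+ (a == b).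

(* The group H(c, k, n); level 0 imposes nothing. *)
Definition patternG (c k n : nat) : set M :=
  [set g | G1 g /\ forall a b, pdvd (level c k n a b) (deviation g a b)].

(** The positions whose level rises by one when k and n do. They index the coordinates of H(c, k, n)
    / H(c, k+1, n+1); the one at (0, 0) is always zero. *)
Definition constrained (c : nat) a b : bool := (a != b) || (a <= c)%N.

Lemma deviationE_off g a b : a != b -> deviation g a b = g a b.
Proof. by rewrite /deviation => /negPf ->; rewrite subr0. Qed.

Lemma deviationE_diag g a : deviation g a a = g a a - g i0 i0.
Proof. by rewrite /deviation eqxx. Qed.

Lemma deviation1 a b : deviation 1%:M a b = 0.
Proof. by rewrite /deviation !mxE eqxx; case: eqP => _; rewrite ?subr0 ?subrr. Qed.

Lemma level_le c k n a b : (k <= n)%N -> (level c k n a b <= n)%N.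
Proof. by rewrite /level => kn; do 3?case: ifP. Qed.

Lemma levelS c k n a b : constrained c a b ->
  level c k.+1 n.+1 a b = (level c k n a b).+1.
Proof.
rewrite /constrained /level; case: (a != b) => //=.
by rewrite leq_eqVlt; case: (a < c)%N => //; rewrite orbF => ->.
Qed.

Lemma level_unconstrained c k n a b : ~~ constrained c a b -> level c k n a b = 0%N.
Proof.
rewrite negb_or negbK /level => /andP[-> /=]; rewrite -ltnNge => ca.
by rewrite ltnNge (ltnW ca) /= gtn_eqF.
Qed.

Lemma Gn_patternG c m l (g : M) : (0 < m)%N -> (l <= m)%N -> Gn m g -> patternG c l m g.
Proof.
move=> m_gt0 lm gG; split=> [|a b]; first exact: Gn_le gG.
apply: pdvd_le (level_le _ _ _ lm) _; have /GnP[_ g1] := gG.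
have := pdvdB (g1 a b) (g1 i0 i0); have := g1 a b; rewrite /deviation !mxE eqxx.
case: (a == b) => /= H H'; rewrite ?mulr0n ?subr0 //; last by rewrite subr0 in H.
by have -> : g a b - g i0 i0 = g a b - 1 - (g i0 i0 - 1) by ring.
Qed.

Section Products.
Variables (c k n : nat) (kn : (k <= n)%N).
Local Notation K := (patternG c k n).

Lemma patternG_off g a b : K g -> a != b -> pdvd n (g a b).
Proof. by move=> [_ /(_ a b)] + ab; rewrite deviationE_off // /level ab. Qed.

Definition cross g h a b := ((g - 1%:M) *m (h - 1%:M)) a b.

Lemma mulmx_cross g h a b :
  (g *m h) a b = cross g h a b + g a b + h a b - (a == b)%:R.
Proof.
have -> : g *m h = (g - 1%:M) *m (h - 1%:M) + g + h - 1%:M.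
  rewrite mulmxBl !mulmxBr !mulmx1 !mul1mx.
  by apply/matrixP => i j; rewrite !mxE; ring.
by rewrite /cross !mxE.
Qed.

(** Every term of the product has an off-diagonal factor, divisible by p^n, and another factor
    divisible by p. *)
Lemma cross_off g h a b : K g -> K h -> a != b -> pdvd n.+1 (cross g h a b).
Proof.
move=> Kg Kh ab; rewrite /cross mxE; apply: pdvd_sum => j _; rewrite !mxE.
have [-> | ja] := eqVneq j a.
  rewrite -add1n; apply: pdvdM; first by have := G1_entry a a Kg.1; rewrite eqxx.
  by rewrite (negPf ab) subr0; exact: patternG_off Kh ab.
rewrite -addn1; apply: pdvdM.
  by rewrite subr0; apply: patternG_off Kg _; rewrite eq_sym.
exact: (G1_entry _ _ Kh.1).
Qed.

Lemma cross_diag g h a : K g -> K h ->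
  pdvd n.+1 (cross g h a a - (g a a - 1) * (h a a - 1)).
Proof.
move=> Kg Kh; rewrite /cross mxE (bigD1 a) //= !mxE eqxx addrAC subrr add0r.
apply: pdvd_sum => j ja; rewrite !mxE -addn1; apply: pdvdM.
  by rewrite eq_sym (negPf ja) subr0; apply: patternG_off Kg _; rewrite eq_sym.
exact: (G1_entry _ _ Kh.1).
Qed.

(** The products g h and h g differ only in their cross terms, which modulo p^(n+1) vanish off the
    diagonal and are symmetric in g and h on it. *)
Lemma patternG_comm g h : K g -> K h -> mxcong n.+1 (g *m h) (h *m g).
Proof.
move=> Kg Kh a b; rewrite !mulmx_cross.
have -> : cross g h a b + g a b + h a b - (a == b)%:R -
    (cross h g a b + h a b + g a b - (a == b)%:R) = cross g h a b - cross h g a b by ring.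
have [<-|ab] := eqVneq a b; last by apply: pdvdB; exact: cross_off.
have -> : cross g h a a - cross h g a a =
    (cross g h a a - (g a a - 1) * (h a a - 1)) -
    (cross h g a a - (h a a - 1) * (g a a - 1)) by ring.
by apply: pdvdB; exact: cross_diag.
Qed.

(** On the diagonal the error is, modulo p^(n+1), a difference of products (g_aa - 1)(h_aa - 1) -
    (g_00 - 1)(h_00 - 1). Telescoping it pairs a deviation with a factor divisible by p, which gains
    one level. *)
Lemma deviationM g h a b : K g -> K h -> constrained c a b ->
  pdvd (level c k n a b).+1
    (deviation (g *m h) a b - (deviation g a b + deviation h a b)).
Proof.
move=> Kg Kh cab; have [e|ab] := eqVneq a b; last first.
  rewrite !deviationE_off // mulmx_cross (negPf ab) /level ab.
  have -> : forall X Y Z : padic_int p, X + Y + Z - 0 - (Y + Z) = X by move=> *; ring.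
  exact: cross_off.
subst b; rewrite !deviationE_diag !mulmx_cross !eqxx.
set l := level c k n a a.
have -> : cross g h a a + g a a + h a a - 1%:R -
    (cross g h i0 i0 + g i0 i0 + h i0 i0 - 1%:R) -
    (g a a - g i0 i0 + (h a a - h i0 i0)) =
  (cross g h a a - (g a a - 1) * (h a a - 1)) -
  (cross g h i0 i0 - (g i0 i0 - 1) * (h i0 i0 - 1)) +
  ((g a a - g i0 i0) * (h a a - 1) + (g i0 i0 - 1) * (h a a - h i0 i0)) by ring.
have ln : (l.+1 <= n.+1)%N by rewrite ltnS level_le.
apply: pdvdD; first by apply: pdvdB; apply: pdvd_le ln _; exact: cross_diag.
have [gG /(_ a a)] := Kg; have [hG /(_ a a)] := Kh; rewrite !deviationE_diag -/l => hl gl.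
have := G1_entry a a hG; have := G1_entry i0 i0 gG; rewrite !eqxx => g1 h1.
by apply: pdvdD; [rewrite -addn1|rewrite -add1n]; exact: pdvdM.
Qed.

Lemma patternGM g h : K g -> K h -> K (g *m h).
Proof.
move=> Kg Kh; split; first by apply: GnM; [exact: Kg.1|exact: Kh.1].
move=> a b; have [cab|/level_unconstrained ->] := boolP (constrained c a b);
  last exact: pdvd_n0.
rewrite -[deviation _ a b](subrK (deviation g a b + deviation h a b)).
apply: pdvdD; first exact: pdvd_le (deviationM Kg Kh cab).
by apply: pdvdD; [exact: Kg.2|exact: Kh.2].
Qed.

Lemma patternG1 : K 1%:M.
Proof. by split; [exact: Gn1|move=> a b; rewrite deviation1; exact: pdvd0]. Qed.

(** The leading digit of the deviation. At constrained positions these are characters of H(c, k, n)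
    by [chiM], and by [chi_eq0] an element on which they all vanish lies in H(c, k+1, n+1). *)
Definition congr_char g a b : 'F_p := digit (level c k n a b) (deviation g a b).

Lemma chiM g h a b : K g -> K h -> constrained c a b ->
  congr_char (g *m h) a b = congr_char g a b + congr_char h a b.
Proof.
move=> Kg Kh cab; rewrite /congr_char -digitD //; [|exact: Kg.2|exact: Kh.2].
by apply: digit_eq (deviationM Kg Kh cab) => //; exact: (patternGM Kg Kh).2.
Qed.

Lemma chi_eq0 g : K g -> (forall a b, constrained c a b -> congr_char g a b = 0) ->
  patternG c k.+1 n.+1 g.
Proof.
move=> Kg chi0; split=> [|a b]; first exact: Kg.1.
have [cab|/level_unconstrained ->] := boolP (constrained c a b); last exact: pdvd_n0.
by rewrite levelS //; apply/(digit_eq0 hp (Kg.2 a b))/chi0.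
Qed.

Definition mxpow g m := iter m (mulmx g) 1%:M.

Lemma mxpowP g m : K g -> K (mxpow g m) /\
  forall a b, constrained c a b -> congr_char (mxpow g m) a b = m%:R * congr_char g a b.
Proof.
move=> Kg; elim: m => [|m [Km chim]]; (split; [|move=> a b cab]).
- exact: patternG1.
- by rewrite /congr_char deviation1 digit0 // mul0r.
- exact: patternGM.
- by rewrite [mxpow g m.+1]/(g *m mxpow g m) chiM // chim // -natr1 mulrDl mul1r addrC.
Qed.

Lemma elem_patternG a b z : a != b -> (0 < n)%N ->
  K (elem_mx a b (p%:R ^+ n * z)) /\
  forall a' b', constrained c a' b' ->
    congr_char (elem_mx a b (p%:R ^+ n * z)) a' b' =
      if (a' == a) && (b' == b) then padic_red z else 0.
Proof.
move=> ab n_gt0; set g := elem_mx _ _ _.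
have gE a' b' : deviation g a' b' = p%:R ^+ n * z * ((a' == a) && (b' == b))%:R.
  rewrite /deviation !elem_mxE eqxx /=.
  have -> : (i0 == a) && (i0 == b) = false.
    by apply: contraNF ab => /andP[/eqP <- /eqP <-].
  by case: (a' =P b') => _ /=; rewrite ?mulr0 ?addr0 ?mulr0n ?subr0 ?add0r // addrAC subrr add0r.
have gl a' b' : pdvd (level c k n a' b') (deviation g a' b').
  by rewrite gE; apply/pdvdMr/pdvdMr/(pdvd_le (level_le _ _ _ kn))/pdvd_pX.
split; first by split=> //; apply: Gn_elem => //; apply/pdvdMr/(pdvd_le n_gt0)/pdvd_pX.
move=> a' b' _; rewrite /congr_char gE; case: ifP => [/andP[/eqP -> /eqP ->]|_].
  by rewrite mulr1 /level ab digit_pX.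
by rewrite mulr0 digit0.
Qed.

End Products.
End CongruencePatterns.

(** * Diagonal elements and transvections *)

Section DiagonalElements.
Variables (p d : nat) (hp : prime p).
Local Notation M := 'M[padic_int p]_d.

Definition dgmx (e : 'I_d -> padic_int p) : M := diag_mx (\row_j e j).

Lemma dgmxE e i j : dgmx e i j = e i *+ (i == j).
Proof. by rewrite !mxE. Qed.

Lemma Gn_dgmx n e : (forall j, pdvd n (e j - 1)) -> \prod_j e j = 1 -> Gn n (dgmx e).
Proof.
move=> e1 pe; apply/GnP; split.
  by rewrite det_diag -[RHS]pe; apply: eq_bigr => j _; rewrite mxE.
move=> i j; rewrite dgmxE mxE; case: (i =P j) => _; first exact: e1.
by rewrite subrr; exact: pdvd0.
Qed.

Lemma prod_if_eq (a : 'I_d) (y : padic_int p) : \prod_j (if j == a then y else 1) = y.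
Proof.
by rewrite (bigD1 a) //= eqxx big1 ?mulr1 // => j /negPf ->.
Qed.

Variables (i0 c : 'I_d).
Hypotheses (i0E : i0 = 0%N :> nat) (c_gt0 : (0 < c)%N) (cp : (c.+1 < p)%N).

Lemma c_neq0 : i0 != c.
Proof. by apply/eqP => e; move: c_gt0; rewrite -e i0E. Qed.

(** Take t = diag(a, ..., a, a^-c, 1, ..., 1) with a = 1 + p^k repeated c times. Then t_cc - t_00 =
    - a^-c (a^(c+1) - 1) is p^k times a unit, because the geometric sum is c + 1 modulo p and c + 1
    < p. *)
Lemma torus_element k : (0 < k)%N ->
  exists t : M, exists tau : padic_int p,
    [/\ G1 t, forall i j, i != j -> t i j = 0,
        forall i : 'I_d, (i < c)%N -> t i i = t i0 i0,
        t c c - t i0 i0 = p%:R ^+ k * tau & padic_red tau != 0].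
Proof.
move=> k_gt0; set a : padic_int p := 1 + p%:R ^+ k.
have a1 : pdvd 1 (a - 1).
  by rewrite /a addrAC subrr add0r; exact/(pdvd_le k_gt0)/pdvd_pX.
have [ai aai ai1] := padic_inv hp a1.
have pw1 m : pdvd 1 (ai ^+ m - 1).
  by rewrite subrX1; exact: pdvdMr.
pose e (j : 'I_d) := if (j < c)%N then a else if j == c then ai ^+ c else 1.
have tE i : dgmx e i i = e i by rewrite dgmxE eqxx.
have e0 : e i0 = a by rewrite /e i0E c_gt0.
have ec : e c = ai ^+ c by rewrite /e ltnn eqxx.
exists (dgmx e), (- (ai ^+ c * \sum_(i < c.+1) a ^+ i)); split.
- apply: Gn_dgmx => [j|].
    rewrite /e; case: ifP => // _; case: ifP => // _.
    by rewrite subrr; exact: pdvd0.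
  rewrite (eq_bigr (fun j : 'I_d => (if (j < c)%N then a else 1) *
      (if j == c then ai ^+ c else 1))); last first.
    move=> j _; rewrite /e; case: ltnP => jc; last by rewrite mul1r.
    by case: eqP => [jE|_]; [rewrite jE ltnn in jc|rewrite mulr1].
  rewrite big_split /= prod_if_eq -big_mkcond -(big_ord_widen d (fun=> a)) ?(ltnW (ltn_ord c)) //.
  by rewrite prodr_const card_ord -exprMn aai expr1n.
- by move=> i j /negPf ij; rewrite dgmxE ij.
- by move=> i ic; rewrite !tE e0 /e ic.
- rewrite !tE e0 ec; have := subrX1 a c.+1; rewrite {2}/a addrAC subrr add0r => e1.
  rewrite mulrN mulrCA -e1 -mulrN opprB mulrBr mulr1 exprS mulrCA -exprMn [ai * a]mulrC aai expr1n.
  by rewrite mulr1.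
- rewrite padic_redN // padic_redM // oppr_eq0.
  have red1 (x : padic_int p) : pdvd 1 (x - 1) -> padic_red x = 1.
    move=> x1; have r1 : padic_red (1 : padic_int p) = 1 := padic_red_natr hp 1.
    by rewrite -(subrK 1 x) padic_redD // r1 (_ : padic_red (x - 1) = 0) ?add0r //; apply/padic_red_eq0.
  rewrite red1 ?mul1r //.
  suff -> : padic_red (\sum_(i < c.+1) a ^+ i) = c.+1%:R.
    by rewrite Fp_natr_eq0 // gtnNdvd.
  elim: c.+1 => [|m IHm]; first by rewrite big_ord0 (padic_red_natr hp 0).
  rewrite big_ord_recr /= padic_redD // IHm red1 ?natr1 //.
  by rewrite subrX1; exact: pdvdMr.
Qed.

Section Generators.
Variables (k n : nat) (k_gt0 : (0 < k)%N) (kn : (k < n)%N).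
Local Notation K := (patternG i0 c k n).
Local Notation chi := (congr_char i0 c k n).

(* Positions of the entries that are not moved by the SL2 at coordinates 0, c. *)
Definition spectator (q : 'I_d * 'I_d) : bool :=
  [&& constrained c q.1 q.2, q != (i0, i0), q != (c, c), q != (i0, c) & q != (c, i0)].

(** Off the diagonal a transvection with entry p^n serves. At a diagonal position 0 < a < c the
    witness has 1 + p^n at a and its inverse at c. *)
Lemma generator_element q : spectator q ->
  exists e : M, K e /\
    forall a b, constrained c a b -> chi e a b = ((a, b) == q)%:R.
Proof.
case: q => a b /and5P[/= cab n00 ncc _ _].
have n_gt0 : (0 < n)%N by apply: leq_ltn_trans kn.
have [e|ab] := eqVneq a b; last first.
  have [Ke chie] := elem_patternG hp i0 c (ltnW kn) 1 ab n_gt0.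
  exists (elem_mx a b (p%:R ^+ n * 1)); split=> // a' b' /chie ->.
  by rewrite xpair_eqE (padic_red_natr hp 1); case: (_ && _).
subst b; rewrite /constrained eqxx /= in cab.
have a0 : a != i0 by apply: contraNneq n00 => ->.
have ac : a != c by apply: contraNneq ncc => ->.
have lac : (a < c)%N by rewrite ltn_neqAle cab andbT.
have pn1 : pdvd n (1 + p%:R ^+ n - 1 : padic_int p).
  by rewrite addrAC subrr add0r; exact: pdvd_pX.
have [y xy _] := padic_inv hp (pdvd_le n_gt0 pn1).
have yn : pdvd n (y - 1).
  have -> : y - 1 = - ((1 + p%:R ^+ n - 1) * y) by rewrite mulrBl xy; ring.
  exact/pdvdN/pdvdMr.
pose e (j : 'I_d) := (if j == a then 1 + p%:R ^+ n else 1) * (if j == c then y else 1).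
have e0 : e i0 = 1 by rewrite /e eq_sym (negPf a0) (negPf c_neq0) mulr1.
have ea : e a = 1 + p%:R ^+ n by rewrite /e eqxx (negPf ac) mulr1.
have en j : pdvd n (e j - 1).
  rewrite /e; case: ifP => _; case: ifP => _; rewrite ?mulr1 ?mul1r //.
    by rewrite xy subrr; exact: pdvd0.
  by rewrite subrr; exact: pdvd0.
have devE i j : deviation i0 (dgmx e) i j = (e i - 1) *+ (i == j).
  rewrite /deviation !dgmxE eqxx e0; case: (i =P j) => _ //=.
  by rewrite mulr0n subrr.
exists (dgmx e); split.
  split; last first.
    move=> i j; rewrite devE; case: (i == j); last by exact: pdvd0.
    exact: pdvd_le (level_le _ _ _ (ltnW kn)) (en i).
  apply: Gn_le n_gt0 _; apply: Gn_dgmx => //.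
  by rewrite big_split /= !prod_if_eq.
move=> i j cij; rewrite /congr_char devE xpair_eqE; case: (i =P j) => [<-|ij]; last first.
  rewrite digit0 //; case: eqP => //= ia; case: eqP => // ja.
  by rewrite ia ja in ij.
rewrite andbb; case: (i =P a) => [->|/eqP ia].
  by rewrite ea addrAC subrr add0r /level eqxx lac -[X in digit _ X]mulr1 digit_pX // (padic_red_natr hp 1).
apply/(digit_eq0 hp); first exact: pdvd_le (level_le _ _ _ (ltnW kn)) (en i).
(* The compensating entry at c is 1 modulo p^n, and k < n, so the coordinate at (c, c), of level k,
   vanishes. *)
case: (i =P c) => [->|/eqP ic]; last by rewrite /e (negPf ia) (negPf ic) mulr1 subrr; exact: pdvd0.
by rewrite /level !eqxx ltnn; apply: pdvd_le (en c).
Qed.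

(** Moving t through a transvection of depth n - k creates the entry p^(n-k) x (t_bb - t_aa), of
    depth n; modulo p^(n+1) the factor t_aa counts as 1. *)
Lemma elem_torus_conj (a b : 'I_d) (t : M) (tau x : padic_int p) : a != b ->
    G1 t -> (forall i j, i != j -> t i j = 0) -> t b b - t a a = p%:R ^+ k * tau ->
  mxcong n.+1 (elem_mx a b (p%:R ^+ (n - k) * x) *m t)
    (t *m (elem_mx a b (p%:R ^+ n * (x * tau)) *m elem_mx a b (p%:R ^+ (n - k) * x))).
Proof.
move=> ab tG tdiag ttau i j; rewrite mulmxA elem_mulmxE !mulmx_elemE (negPf ab) mul0r addr0.
have -> : t b j = t b b *+ (j == b).
  by rewrite eq_sym; case: (b =P j) => [->//|/eqP bj]; rewrite tdiag.
have -> : t i a = t a a *+ (i == a).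
  by case: (i =P a) => [->//|/eqP ia]; rewrite tdiag.
case: (i == a); case: (j == b); rewrite ?mulr0n ?mulr1n ?mul0r ?mulr0 ?addr0 ?subrr ?mul1r; try exact: pdvd0.
have -> : t b b = t a a + p%:R ^+ k * tau by rewrite -ttau addrC subrK.
have nE : p%:R ^+ n = p%:R ^+ (n - k) * p%:R ^+ k :> padic_int p.
  by rewrite -exprD subnK // ltnW.
have -> : t i j + p%:R ^+ (n - k) * x * (t a a + p%:R ^+ k * tau) -
    (t i j + p%:R ^+ n * (x * tau) * t a a + p%:R ^+ (n - k) * x * t a a) =
  p%:R ^+ n * (x * tau) * - (t a a - 1) by rewrite nE; ring.
rewrite -addn1; apply: pdvdM; first exact/pdvdMr/pdvd_pX.
by apply: pdvdN; have := G1_entry a a tG; rewrite eqxx.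
Qed.

(** The two products differ by z w (E_aa - E_bb). *)
Lemma elem_elem_comm (a b : 'I_d) m1 m2 (z w : padic_int p) : pdvd m1 z -> pdvd m2 w ->
  mxcong (m1 + m2) (elem_mx a b z *m elem_mx b a w) (elem_mx b a w *m elem_mx a b z).
Proof.
move=> z1 w2 i j; rewrite elem_mulmxE mulmx_elemE !elem_mxE !eqxx andbT /=.
set X := _ - _.
have -> : X = z * w * (((i == a) && (j == a))%:R - ((i == b) && (j == b))%:R).
  rewrite /X [b == j]eq_sym.
  by case: (i == a); case: (j == b); case: (j == a); case: (i == b); rewrite /=; ring.
exact/pdvdMr/pdvdM.
Qed.

(** The entries of h at (0, 0) and (c, c) agree modulo p^(k+1), which together with the depth n - k
    of z gives n + 1; the off-diagonal entries of h are themselves divisible by p^(n+1). *)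
Lemma elem_pattern_comm (a b : 'I_d) (z : padic_int p) (h : M) :
    (a, b) \in [:: (i0, c); (c, i0)] -> pdvd (n - k) z ->
    patternG i0 c k.+1 n.+1 h ->
  mxcong n.+1 (elem_mx a b z *m h) (h *m elem_mx a b z).
Proof.
move=> abP zn Hh i j; rewrite elem_mulmxE mulmx_elemE.
have hoff i' j' : i' != j' -> pdvd n.+1 (h i' j') by exact: (patternG_off Hh).
have -> : forall X Y Z : padic_int p, X + Y - (X + Z) = Y - Z by move=> *; ring.
have [->|ia] := eqVneq i a; have [->|jb] := eqVneq j b; rewrite ?mul1r ?mul0r ?subr0 ?sub0r.
- rewrite -mulrBr; have -> : n.+1 = (n - k + k.+1)%N by rewrite addnS subnK ?(ltnW kn).
  apply: pdvdM => //; have := Hh.2 c c; rewrite deviationE_diag /level !eqxx ltnn /= => hc.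
  move: abP; rewrite !inE => /orP[] /eqP[-> ->] //.
  by rewrite -opprB; exact: pdvdN.
- by apply/pdvdMl/hoff; rewrite eq_sym.
- exact/pdvdN/pdvdMl/hoff.
- exact: pdvd0.
Qed.

End Generators.
End DiagonalElements.

(** * The basic inequality *)

(** Three distinct points (1, i, i^2) of the conic form a basis of F^3; the witnesses are the
    Lagrange coefficients. *)
Lemma vandermonde3 (F : fieldType) (i j l s0 s1 s2 : F) :
    i != j -> i != l -> j != l ->
  exists A B C : F, [/\ A + B + C = s0, i * A + j * B + l * C = s1
                      & i ^+ 2 * A + j ^+ 2 * B + l ^+ 2 * C = s2].
Proof.
rewrite -(subr_eq0 i j) -(subr_eq0 i l) -(subr_eq0 j l) => ij il jl.
exists ((s2 - (j + l) * s1 + j * l * s0) / ((i - j) * (i - l))),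
  (- (s2 - (i + l) * s1 + i * l * s0) / ((i - j) * (j - l))),
  ((s2 - (i + j) * s1 + i * j * s0) / ((i - l) * (j - l))).
by split; field; rewrite ij il jl.
Qed.

Section FixedSpaces.
Variables (p d : nat) (hp : prime p).
Local Notation M := 'M[padic_int p]_d.
Variables (V : vectType 'F_p) (rho : M -> 'End(V)) (fixs : set M -> {vspace V}).
Hypothesis rho1 : forall v, rho 1%:M v = v.
Hypothesis rhoM : forall g h, G1 g -> G1 h -> forall v, rho (g *m h) v = rho g (rho h v).
Hypothesis fixsP : forall H v, v \in fixs H <-> forall g, H g -> rho g v = v.

Lemma rho_inj g v w : G1 g -> rho g v = rho g w -> v = w.
Proof.
move=> gG e; have /GnP[g1 _] := gG.
rewrite -(rho1 v) -(rho1 w) -(SL_adjK g1).2 !rhoM ?e //; exact: Gn_adj.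
Qed.

(** On vectors fixed by G(m) the action depends only on residues modulo p^m, since x = y z with z in
    G(m). *)
Lemma rho_mxcong m x y v : (0 < m)%N -> G1 x -> G1 y -> mxcong m x y ->
  (forall g, Gn m g -> rho g v = v) -> rho x v = rho y v.
Proof.
move=> m_gt0 xG yG xy vm; have /GnP[x1 _] := xG; have /GnP[y1 _] := yG.
have [z zm ->] := mxcong_coset x1 y1 xy.
by rewrite rhoM ?(vm z) //; exact: (Gn_le m_gt0 zm).
Qed.

Lemma fixsS (H H' : set M) : H `<=` H' -> (fixs H' <= fixs H)%VS.
Proof.
by move=> HH; apply/subvP => v /fixsP vH; apply/fixsP => g /HH; exact: vH.
Qed.

Definition fixer v : set M := [set g | G1 g /\ rho g v = v].

Lemma fixerM v x y : fixer v x -> fixer v y -> fixer v (x *m y).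
Proof.
by move=> [xG xv] [yG yv]; split; [exact: GnM|rewrite rhoM // yv].
Qed.

Lemma fixer_pow v x m : fixer v x -> fixer v (mxpow x m).
Proof.
move=> xv; elim: m => [|m IHm]; first by split; [exact: Gn1|exact: rho1].
exact: fixerM.
Qed.

Lemma fixer_cancel v x y : G1 x -> fixer v y -> fixer v (x *m y) -> fixer v x.
Proof. by move=> xG [yG yv] [_]; rewrite rhoM // yv => xv; split. Qed.

Lemma rho_mxpow x m v : G1 x -> rho (mxpow x m) v = iter m (rho x) v.
Proof.
move=> xG; suff [] : G1 (mxpow x m) /\ rho (mxpow x m) v = iter m (rho x) v by [].
elim: m => [|m [IG IHm]]; first by split; [exact: Gn1|exact: rho1].
by split; [exact: GnM|rewrite iterS -IHm -rhoM].
Qed.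

Definition delta g : 'End(V) := rho g - \1%VF.

Lemma deltaE g v : delta g v = rho g v - v.
Proof. by rewrite add_lfunE opp_lfunE id_lfunE. Qed.

Lemma mem_fix_lker g v : (v \in lker (delta g)) = (rho g v == v).
Proof. by rewrite memv_ker deltaE subr_eq0. Qed.

Variables (i0 c : 'I_d).
Hypotheses (i0E : i0 = 0%N :> nat) (c_gt0 : (0 < c)%N) (cp : (c.+1 < p)%N).
Variables (k n : nat) (k_gt0 : (0 < k)%N) (kn : (k < n)%N).
Local Notation K := (@patternG p d i0 c k n).
Local Notation N := (@patternG p d i0 c k.+1 n.+1).
Local Notation W := (fixs N).

Let n_gt0 : (0 < n)%N := leq_ltn_trans (leq0n k) kn.

Lemma fixN_congruence v : v \in W -> forall g, Gn n.+1 g -> rho g v = v.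
Proof.
move=> /fixsP vN g gn; apply: vN; apply: Gn_patternG gn => //; exact: ltnW.
Qed.

(** Commutators of K lie in G(n+1), which is contained in N and so acts trivially on W. *)
Lemma rho_comm g h v : K g -> K h -> v \in W -> rho g (rho h v) = rho h (rho g v).
Proof.
move=> Kg Kh vW; have gG := Kg.1; have hG := Kh.1.
rewrite -!rhoM //; apply: (@rho_mxcong n.+1) => //.
- exact: GnM.
- exact: GnM.
- exact: patternG_comm Kg Kh.
- exact: fixN_congruence.
Qed.

Lemma patternGS g : N g -> K g.
Proof.
move=> [gG gN]; split=> // a b; apply: pdvd_le (gN a b); rewrite /level.
by do 3?case: ifP.
Qed.

Lemma rho_stab g v : K g -> v \in W -> rho g v \in W.
Proof.
move=> Kg vW; apply/fixsP => h Nh; rewrite rho_comm //; last exact: patternGS.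
by have /fixsP -> := vW.
Qed.

Lemma delta_comm g h v : K g -> K h -> v \in W ->
  delta g (delta h v) = delta h (delta g v).
Proof.
move=> Kg Kh vW; rewrite !deltaE !opprB !linearB /= (rho_comm Kg Kh vW) -!addrA.
by congr (_ + _); rewrite addrCA [in RHS]addrCA [- _ - _]addrC.
Qed.

Lemma delta_stab g v : K g -> v \in W -> delta g v \in W.
Proof. by move=> Kg vW; rewrite deltaE rpredB // rho_stab. Qed.

Definition Kstable (Y : {vspace V}) := (Y <= W)%VS /\
  forall g v, K g -> v \in Y -> rho g v \in Y.

Lemma Kstable_fix : Kstable W.
Proof. by split=> // g v; exact: rho_stab. Qed.

Lemma Kstable_cap Y g : K g -> Kstable Y -> Kstable (Y :&: lker (delta g)).
Proof.
move=> Kg [YW Ys]; split; first exact: subv_trans (capvSl _ _) YW.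
move=> h v Kh; rewrite !memv_cap !mem_fix_lker => /andP[Yv /eqP gv].
by rewrite Ys //= rho_comm // ?gv //; exact: (subvP YW).
Qed.

(** The quotient K / N has exponent p, so g^p fixes W, and g is unipotent there. *)
Lemma iter_rho_sub1 g v : K g -> v \in W -> iter p (delta g) v = 0.
Proof.
move=> Kg vW; apply: iter_unipotent0 => //.
rewrite (@eq_iter _ _ (rho g)); last first.
  by move=> w; rewrite /= deltaE subrK.
rewrite -rho_mxpow; last exact: Kg.1.
have /fixsP := vW; apply; have [Kp chip] := mxpowP hp (ltnW kn) p Kg.
by apply: (chi_eq0 hp Kp) => a b /chip ->; rewrite pchar_Fp_0 // mul0r.
Qed.

Lemma dim_fix_generator Y g : K g -> Kstable Y ->
  (\dim Y <= p * \dim (Y :&: lker (delta g)))%N.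
Proof.
move=> Kg [YW Ys]; apply: dim_le_nilpotent => v Yv.
  by rewrite deltaE rpredB // Ys.
by apply: iter_rho_sub1 => //; exact: (subvP YW).
Qed.

Definition cap_fix (Y : {vspace V}) (gs : seq M) : {vspace V} :=
  foldr (fun g Z => (Z :&: lker (delta g))%VS) Y gs.

(** Imposing invariance under one more element of K costs at most a factor p and keeps the space
    K-stable. *)
Lemma dim_cap_fix Y gs : (forall g, g \in gs -> K g) -> Kstable Y ->
  Kstable (cap_fix Y gs) /\ (\dim Y <= p ^ size gs * \dim (cap_fix Y gs))%N.
Proof.
move=> + Ys; elim: gs => [|g gs IHgs] Kgs /=; first by rewrite mul1n.
have Kg : K g by apply: Kgs; exact: mem_head.
have [|Ks le] := IHgs; first by move=> h hgs; apply: Kgs; rewrite inE hgs orbT.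
split; first exact: Kstable_cap.
apply: leq_trans le _; rewrite expnSr -mulnA leq_mul2l; apply/orP; right.
exact: dim_fix_generator.
Qed.

Lemma mem_cap_fix Y gs v : v \in cap_fix Y gs ->
  v \in Y /\ forall g, g \in gs -> rho g v = v.
Proof.
elim: gs => [|h gs IHgs] //=; rewrite memv_cap mem_fix_lker => /andP[/IHgs[Yv gv] /eqP hv].
by split=> // g; rewrite inE => /orP[/eqP -> //|]; exact: gv.
Qed.

(** * Conjugates of the torus element *)

Section Shears.
Variables (t : M) (tau : padic_int p).
Hypotheses (tG : G1 t) (tdiag : forall i j, i != j -> t i j = 0).
Hypothesis tlow : forall i : 'I_d, (i < c)%N -> t i i = t i0 i0.
Hypotheses (ttau : t c c - t i0 i0 = p%:R ^+ k * tau) (tau_unit : padic_red tau != 0).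
Local Notation chi := (congr_char i0 c k n).
Local Notation T := (padic_red tau).
Local Notation ic := (c_neq0 i0E c_gt0).

Let ci : c != i0. Proof. by rewrite eq_sym ic. Qed.

(** An explicit form, modulo p^(n+1), of the conjugate of t by [conjugator i]. Its coordinates T, i
    T and - i^2 T at (c, c), (0, c) and (c, 0) trace a conic. *)
Definition shear (i : nat) : M := t *m (elem_mx i0 c (p%:R ^+ n * (i%:R * tau))
  *m elem_mx c i0 (p%:R ^+ n * ((i ^ 2)%:R * - tau))).

Definition conjugator (i : nat) : M :=
  elem_mx i0 c (p%:R ^+ (n - k) * i%:R) *m elem_mx c i0 (p%:R ^+ (n - k) * (i ^ 2)%:R).

Lemma torus_deviation a b : constrained c a b ->
  deviation i0 t a b = if (a == c) && (b == c) then p%:R ^+ k * tau else 0.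
Proof.
rewrite /constrained; have [<-|ab] := eqVneq a b => /= cab; last first.
  rewrite deviationE_off // tdiag //; case: ifP => // /andP[/eqP ac /eqP bc].
  by rewrite ac bc eqxx in ab.
rewrite deviationE_diag andbb; case: eqP => [->//|/eqP ac].
by rewrite tlow ?subrr // ltn_neqAle cab andbT.
Qed.

Lemma level_cc m : level c k m c c = k.
Proof. by rewrite /level !eqxx ltnn. Qed.

Lemma torus_mem m : patternG i0 c k m t.
Proof.
split=> // a b; have [cab|/level_unconstrained ->] := boolP (constrained c a b);
  last exact: pdvd_n0.
rewrite torus_deviation //; case: ifP => [/andP[/eqP -> /eqP ->]|_]; last exact: pdvd0.
by rewrite level_cc; exact/pdvdMr/pdvd_pX.
Qed.

Lemma chi_torus a b : constrained c a b ->
  chi t a b = if (a == c) && (b == c) then T else 0.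
Proof.
move=> cab; rewrite /congr_char torus_deviation //.
by case: ifP => [/andP[/eqP -> /eqP ->]|_]; rewrite ?level_cc ?digit_pX ?digit0.
Qed.

Lemma shear_patternG i : K (shear i) /\ forall a b, constrained c a b ->
  chi (shear i) a b = (if (a == c) && (b == c) then T else 0) +
    ((if (a == i0) && (b == c) then i%:R * T else 0) +
     (if (a == c) && (b == i0) then - (i%:R ^+ 2 * T) else 0)).
Proof.
have Kt := torus_mem n; have chit := chi_torus.
have [K1 chi1] := elem_patternG hp i0 c (ltnW kn) (i%:R * tau) ic n_gt0.
have [K2 chi2] := elem_patternG hp i0 c (ltnW kn) ((i ^ 2)%:R * - tau) ci n_gt0.
have K12 := patternGM (ltnW kn) K1 K2.
split=> [|a b cab]; first exact: (patternGM (ltnW kn) Kt K12).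
rewrite (chiM hp (ltnW kn) Kt K12) // (chiM hp (ltnW kn) K1 K2) // chit // chi1 // chi2 //.
by rewrite !padic_redM // !padic_red_natr // padic_redN // natrX mulrN.
Qed.

Lemma conjugator_G1 i : G1 (conjugator i).
Proof.
have nk : (0 < n - k)%N by rewrite subn_gt0.
by apply: GnM; apply: Gn_elem; rewrite ?ic ?ci //; apply/pdvdMr/(pdvd_le nk)/pdvd_pX.
Qed.

(** With E1, E2 the factors of the conjugator and F1, F2 those of the shear, E1 E2 t becomes E1 t F2
    E2, then t F1 E1 F2 E2, and finally t F1 F2 E1 E2. The last exchange costs only depth 2n - k >=
    n + 1. *)
Lemma shear_conj i : mxcong n.+1 (shear i *m conjugator i) (conjugator i *m t).
Proof.
rewrite /shear /conjugator.
set F1 := elem_mx i0 c (p%:R ^+ n * _); set F2 := elem_mx c i0 (p%:R ^+ n * _).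
set E1 := elem_mx i0 c (p%:R ^+ (n - k) * _); set E2 := elem_mx c i0 (p%:R ^+ (n - k) * _).
have H1 : mxcong n.+1 (E1 *m t) (t *m (F1 *m E1)).
  exact: (elem_torus_conj kn i%:R ic tG tdiag ttau).
have H2 : mxcong n.+1 (E2 *m t) (t *m (F2 *m E2)).
  apply: (elem_torus_conj kn (i ^ 2)%:R ci tG tdiag).
  by rewrite -opprB ttau mulrN.
have H3 : mxcong n.+1 (E1 *m F2) (F2 *m E1).
  apply: (@mxcong_le _ _ _ (n - k + n)); first by rewrite -addn1 addnC leq_add2r subn_gt0.
  by apply: elem_elem_comm; apply/pdvdMr/pdvd_pX.
clearbody F1 F2 E1 E2; apply: mxcong_sym; rewrite -mulmxA.
apply: (mxcong_trans (mxcongM (mxcong_refl _ E1) H2)).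
rewrite mulmxA; apply: (mxcong_trans (mxcongM H1 (mxcong_refl _ _))).
have -> : t *m (F1 *m E1) *m (F2 *m E2) = t *m F1 *m (E1 *m F2 *m E2) by rewrite !mulmxA.
have -> : t *m (F1 *m F2) *m (E1 *m E2) = t *m F1 *m (F2 *m E1 *m E2) by rewrite !mulmxA.
exact: (mxcongM (mxcong_refl _ _) (mxcongM H3 (mxcong_refl _ _))).
Qed.

(** The conjugator has depth only n - k and need not lie in K, but it commutes with N modulo
    G(n+1). *)
Lemma conjugator_stab i v : v \in W -> rho (conjugator i) v \in W.
Proof.
move=> vW; apply/fixsP => h Nh; have uG := conjugator_G1 i; have hG := Nh.1.
rewrite -rhoM // (@rho_mxcong n.+1 _ (conjugator i *m h)) //.
- by rewrite rhoM //; have /fixsP -> := vW.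
- exact: GnM.
- exact: GnM.
- apply: mxcong_sym; rewrite /conjugator.
  set E1 := elem_mx i0 c _; set E2 := elem_mx c i0 _.
  have H1 : mxcong n.+1 (E1 *m h) (h *m E1).
    by apply: (elem_pattern_comm kn) Nh; rewrite ?inE ?eqxx //; apply/pdvdMr/pdvd_pX.
  have H2 : mxcong n.+1 (E2 *m h) (h *m E2).
    by apply: (elem_pattern_comm kn) Nh; rewrite ?inE ?eqxx ?orbT //; apply/pdvdMr/pdvd_pX.
  rewrite -mulmxA; apply: (mxcong_trans (mxcongM (mxcong_refl _ E1) H2)).
  by rewrite !mulmxA; exact: mxcongM H1 (mxcong_refl _ _).
- exact: fixN_congruence.
Qed.

(** The conjugator acts injectively and carries the vectors of W fixed by t to vectors of W fixed by
    the shear. *)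
Lemma dim_fix_shear i :
  (\dim (W :&: lker (delta t)) <= \dim (W :&: lker (delta (shear i))))%N.
Proof.
have uG := conjugator_G1 i; have sG := (shear_patternG i).1.1.
have ker0 : (W :&: lker (delta t) :&: lker (rho (conjugator i)) = 0)%VS.
  apply/eqP; rewrite -subv0; apply/subvP => v; rewrite memv_cap memv_ker memv0 => /andP[_ /eqP u0].
  by apply/eqP/(rho_inj uG); rewrite u0 linear0.
have dimE := limg_dim_eq ker0.
apply: leq_trans (_ : _ <= \dim (rho (conjugator i) @: (W :&: lker (delta t))))%N _.
  by rewrite leq_eqVlt dimE eqxx.
apply/dimvS/subvP => _ /memv_imgP[v vt ->].
move: vt; rewrite memv_cap [X in _ && X]mem_fix_lker => /andP[vW /eqP tv].
rewrite memv_cap (conjugator_stab i vW) andTb mem_fix_lker -(rhoM sG uG).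
have GGs : G1 (shear i *m conjugator i) by exact: (GnM sG uG).
have GGt : G1 (conjugator i *m t) by exact: (GnM uG tG).
rewrite (rho_mxcong (ltn0Sn n) GGs GGt (shear_conj i) (fixN_congruence vW)).
by rewrite (rhoM uG tG) tv.
Qed.

(** Modulo N the three shears and the elements [E q] generate K. Powers of the shears clear the
    coordinates of x at (c, c), (0, c) and (c, 0), powers of the [E q] clear the others, and what
    remains lies in N. *)
Lemma shears_generate i j l (E : 'I_d * 'I_d -> M) v :
    (i < p)%N -> (j < p)%N -> (l < p)%N -> i != j -> i != l -> j != l ->
    (forall q, spectator i0 c q -> K (E q) /\
       forall a b, constrained c a b -> chi (E q) a b = ((a, b) == q)%:R) ->
    v \in W -> rho (shear i) v = v -> rho (shear j) v = v -> rho (shear l) v = v ->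
    (forall q, spectator i0 c q -> rho (E q) v = v) ->
  v \in fixs K.
Proof.
move=> ip jp lp ij il jl EP vW fi fj fl fE.
have lkn := ltnW kn.
have fixN x : N x -> fixer v x by move=> Nx; split; [exact: Nx.1|have /fixsP -> := vW].
have fixE q : spectator i0 c q -> fixer v (E q).
  by move=> sq; split; [exact: (EP q sq).1.1|exact: fE].
have fixS m : rho (shear m) v = v -> fixer v (shear m).
  by move=> fm; split=> //; exact: (shear_patternG m).1.1.
have eqF a b : (a < p)%N -> (b < p)%N -> a != b -> (a%:R : 'F_p) != b%:R.
  move=> ap bp; apply: contraNneq => e.
  have := congr1 (fun z : 'F_p => nat_of_ord z) e; rewrite /= !val_Fp_nat //.
  by rewrite !modn_small // => ->.
(* Induction on a list of spectator positions outside which the coordinates of x vanish; a power of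
   [E q] clears one of them at a time. *)
have lists (s : seq ('I_d * 'I_d)) : {subset s <= spectator i0 c} -> forall x, K x ->
    (forall a b, constrained c a b -> (a, b) \notin s -> chi x a b = 0) -> fixer v x.
  elim: s => [|q s IHs] ss x Kx chix.
    by apply/fixN/(chi_eq0 hp Kx) => a b cab; apply: chix.
  have sq : spectator i0 c q by apply: ss; exact: mem_head.
  have [Kq chiq] := EP q sq.
  have [Kqm chiqm] := mxpowP hp lkn (nat_of_ord (- chi x q.1 q.2)) Kq.
  have fqm := fixer_pow (nat_of_ord (- chi x q.1 q.2)) (fixE q sq).
  apply: (fixer_cancel Kx.1 fqm); apply: IHs.
  - by move=> q' q's; apply: ss; rewrite inE q's orbT.
  - exact: patternGM.
  - move=> a b cab nabs; rewrite (chiM hp lkn) // chiqm // chiq // natr_Zp.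
    have [<-|abq] := eqVneq (a, b) q; first by rewrite mulr1 subrr.
    by rewrite mulr0 addr0 chix // inE negb_or abq.
apply/fixsP => x Kx; suff [] : fixer v x by [].
(* The third right-hand side has the opposite sign because the shear coordinate at (c, 0) is - i^2
   T. *)
have [A [B [C [eA eB eC]]]] := vandermonde3 (- chi x c c / T) (- chi x i0 c / T)
  (chi x c i0 / T) (eqF _ _ ip jp ij) (eqF _ _ ip lp il) (eqF _ _ jp lp jl).
have [Ki chii] := shear_patternG i; have [Kj chij] := shear_patternG j.
have [Kl chil] := shear_patternG l.
have [KiA chiA] := mxpowP hp lkn (nat_of_ord A) Ki.
have [KjB chiB] := mxpowP hp lkn (nat_of_ord B) Kj.
have [KlC chiC] := mxpowP hp lkn (nat_of_ord C) Kl.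
have KBC := patternGM lkn KjB KlC; have KABC := patternGM lkn KiA KBC.
have fABC : fixer v (mxpow (shear i) A *m (mxpow (shear j) B *m mxpow (shear l) C)).
  by do ?apply: fixerM; apply: fixer_pow; exact: fixS.
apply: (fixer_cancel Kx.1 fABC).
apply: (lists (enum (spectator i0 c))); first by move=> q; rewrite mem_enum.
  exact: patternGM.
move=> a b cab; rewrite mem_enum => nsp.
rewrite (chiM hp lkn) // (chiM hp lkn) // (chiM hp lkn) // chiA // chiB // chiC //.
rewrite chii // chij // chil // !natr_Zp.
have : [\/ (a, b) = (i0, i0), (a, b) = (c, c), (a, b) = (i0, c) | (a, b) = (c, i0)].
  have [e1|n1] := eqVneq (a, b) (i0, i0); first by constructor 1.
  have [e2|n2] := eqVneq (a, b) (c, c); first by constructor 2.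
  have [e3|n3] := eqVneq (a, b) (i0, c); first by constructor 3.
  have [e4|n4] := eqVneq (a, b) (c, i0); first by constructor 4.
  by case/negP: nsp; apply/and5P; split.
case=> -[-> ->]; rewrite ?eqxx ?(negPf ic) ?(negPf ci) /= ?addr0 ?add0r ?mulr0 ?addr0.
- by rewrite /congr_char deviationE_diag subrr digit0.
- by rewrite -!mulrDl [A + _]addrA eA divfK // subrr.
- rewrite -[RHS](subrr (chi x i0 c)); congr (_ + _).
  have -> : A * (i%:R * T) + (B * (j%:R * T) + C * (l%:R * T)) =
    (i%:R * A + j%:R * B + l%:R * C) * T by ring.
  by rewrite eB divfK.
- rewrite -[RHS](subrr (chi x c i0)); congr (_ + _).
  have -> : A * - (i%:R ^+ 2 * T) + (B * - (j%:R ^+ 2 * T) + C * - (l%:R ^+ 2 * T)) =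
    - (i%:R ^+ 2 * A + j%:R ^+ 2 * B + l%:R ^+ 2 * C) * T by ring.
  by rewrite eC mulNr divfK.
Qed.

End Shears.

(** The complement contains the four positions of the SL_2 and the d - c - 1 diagonal positions
    beyond c. *)
Lemma card_spectator : (#|spectator i0 c| <= d * d - d + c - 3)%N.
Proof.
pose L := [:: (i0, i0); (c, c); (i0, c); (c, i0)] ++
  [seq (a, a) | a <- enum [pred a : 'I_d | (c < a)%N]].
have ic := c_neq0 i0E c_gt0; have ci : c != i0 by rewrite eq_sym.
have uL : uniq L.
  rewrite cat_uniq /= !inE !xpair_eqE !eqxx !(negPf ic) !(negPf ci) /=.
  rewrite map_inj_uniq ?enum_uniq ?andbT; last by move=> a b [].
  apply/hasPn => _ /mapP[a + ->]; rewrite mem_enum !inE /= => ca.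
  rewrite !xpair_eqE !andbb !negb_or; have -> : (a == c) = false.
    by apply: contraTF ca => /eqP ->; rewrite ltnn.
  rewrite !andbF /= !andbT.
  by apply: contraTneq ca => ->; rewrite i0E.
have card_gt : #|[pred a : 'I_d | (c < a)%N]| = (d - c.+1)%N.
  have := cardC [pred a : 'I_d | (a < c.+1)%N].
  rewrite -sum1_card -(big_ord_widen d (fun=> 1%N)) ?ltn_ord // sum1_card !card_ord => e.
  suff <- : #|[predC [pred a : 'I_d | (a < c.+1)%N]]| = #|[pred a : 'I_d | (c < a)%N]|.
    by apply/eqP; rewrite eq_sym -(eqn_add2l c.+1) e subnKC ?ltn_ord.
  by apply: eq_card => a; rewrite !inE -leqNgt.
have sizeL : size L = (d - c.+1 + 4)%N.
  by rewrite size_cat size_map -cardE card_gt addnC.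
have LC : {subset L <= [predC spectator i0 c]}.
  move=> q; rewrite mem_cat => /orP[|/mapP[a + ->]]; rewrite !inE.
    by case/or4P => /eqP ->; rewrite unfold_in /spectator !eqxx /= ?andbF.
  rewrite mem_enum inE => ca; rewrite unfold_in /spectator /constrained /= eqxx /=.
  by rewrite leqNgt ca.
have := uniq_leq_size uL (s2 := enum [predC spectator i0 c]) _.
rewrite -cardE sizeL => H.
have {}H : (d - c.+1 + 4 <= #|[predC spectator i0 c]|)%N.
  by apply: H => q /LC; rewrite mem_enum.
have := cardC (spectator i0 c); rewrite card_prod card_ord.
move: H (ltn_ord c); have dd : (d <= d * d)%N by case: (d) => // m; rewrite leq_pmulr.
move: #|_| #|_| dd; lia.
Qed.

Theorem fixed_dim_step :
  (\dim (fixs (patternG i0 c k n.+1)) ^ 3 <=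
    16 * (p ^ (d * d - d + c - 3) * \dim (fixs K)) * \dim W ^ 2)%N.
Proof.
have [t [tau [tG tdiag tlow ttau tau_unit]]] := torus_element hp i0E c_gt0 cp k_gt0.
have /choice[E EP] : forall q, exists e : M, spectator i0 c q -> K e /\
    forall a b, constrained c a b -> congr_char i0 c k n e a b = ((a, b) == q)%:R.
  move=> q; have [sq|nsq] := boolP (spectator i0 c q); last by exists 1%:M.
  by have [e He] := generator_element hp i0E c_gt0 kn sq; exists e.
set r := (p ^ (d * d - d + c - 3) * \dim (fixs K))%N.
have Ksh i : K (shear t tau i) by exact: (shear_patternG _ _ _ _ _).1.
have triple i j l : (i < p)%N -> (j < p)%N -> (l < p)%N -> i != j -> i != l -> j != l ->
   (\dim (W :&: lker (delta (shear t tau i)) :&: lker (delta (shear t tau j))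
      :&: lker (delta (shear t tau l))) <= r)%N.
  move=> ip jp lp ij il jl; set Y := (_ :&: lker (delta (shear t tau l)))%VS.
  have KY : Kstable Y by do 3?apply: Kstable_cap => //; exact: Kstable_fix.
  (* Each spectator generator costs a factor p, and after all of them only vectors fixed by K
     remain. *)
  have [|_ le] := @dim_cap_fix Y (map E (enum (spectator i0 c))) _ KY.
    by move=> _ /mapP[q + ->]; rewrite mem_enum => /EP[].
  apply: leq_trans le _; rewrite /r size_map -cardE; apply: leq_mul.
    by rewrite leq_exp2l ?prime_gt1 // card_spectator.
  apply/dimvS/subvP => v /mem_cap_fix[+ fE].
  rewrite memv_cap mem_fix_lker => /andP[+ /eqP fl].
  rewrite memv_cap mem_fix_lker => /andP[+ /eqP fj].
  rewrite memv_cap mem_fix_lker => /andP[vW /eqP fi].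
  apply: (shears_generate tG tdiag tlow ttau tau_unit ip jp lp ij il jl EP) => // q sq.
  by apply: fE; apply: map_f; rewrite mem_enum.
have comW : commuting_on (fun i => delta (shear t tau i)) W.
  by split=> [i v|i j v]; [exact: (delta_stab (Ksh i))|exact: (delta_comm (Ksh i) (Ksh j))].
(* H(c, k, n+1) contains both N and t, so its fixed vectors lie in W and are fixed by t. *)
have leD i : (\dim (fixs (patternG i0 c k n.+1)) <= \dim (W :&: lker (delta (shear t tau i))))%N.
  apply: leq_trans (dim_fix_shear tG tdiag tlow ttau i).
  apply/dimvS/subvP => v /fixsP vH; rewrite memv_cap mem_fix_lker; apply/andP; split.
    apply/fixsP => g [gG gN]; apply: vH; split=> // a b; apply: pdvd_le (gN a b).
    by rewrite /level; do 3?case: ifP.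
  by apply/eqP/vH; exact: (torus_mem tG tdiag tlow ttau).
have p_gt2 : (2 < p)%N by apply: leq_trans cp; rewrite ltnS.
apply: (@cube_ineq _ _ _ (fun i => delta (shear t tau i)) W _ r p id comW) => //.
(* The crude bound D <= p^2 r: start from the space fixed by shear 0 and impose shears 1 and 2,
   distinct modulo p because p > 2. *)
have W0 := Kstable_cap (Ksh 0%N) Kstable_fix.
have W1 := Kstable_cap (Ksh 1%N) W0.
apply: leq_trans (leD 0%N) _; apply: leq_trans (dim_fix_generator (Ksh 1%N) W0) _.
rewrite expnS expn1 -mulnA leq_mul2l; apply/orP; right.
apply: leq_trans (dim_fix_generator (Ksh 2%N) W1) _.
rewrite leq_mul2l; apply/orP; right.
by apply: triple => //; [exact: prime_gt0|exact: prime_gt1].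
Qed.

End FixedSpaces.

(** * Indices *)

Lemma pdvd_prodB (p n : nat) (I : Type) (r : seq I) (E F : I -> padic_int p) :
  (forall i, pdvd n (E i - F i)) -> pdvd n (\prod_(i <- r) E i - \prod_(i <- r) F i).
Proof.
move=> EF; apply: (big_rec2 (fun x y => pdvd n (x - y))) => [|i x y _ xy].
  by rewrite subrr; exact: pdvd0.
have -> : E i * x - F i * y = (E i - F i) * x + F i * (x - y) by ring.
by apply: pdvdD; [exact: pdvdMr|exact: pdvdMl].
Qed.

Lemma mxcong_det (p n m : nat) (A B : 'M[padic_int p]_m) :
  mxcong n A B -> pdvd n (\det A - \det B).
Proof.
move=> AB; rewrite /determinant -sumrB; apply: pdvd_sum => s _.
rewrite -mulrBr; apply/pdvdMl/pdvd_prodB => i; exact: AB.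
Qed.

Lemma mxcong_cofactor (p n d : nat) (A B : 'M[padic_int p]_d) i j :
    (forall a b, a != i -> b != j -> pdvd n (A a b - B a b)) ->
  pdvd n (cofactor A i j - cofactor B i j).
Proof.
move=> AB; rewrite /cofactor -mulrBr; apply/pdvdMl/mxcong_det => a b.
by rewrite !mxE; apply: AB; rewrite eq_sym neq_lift.
Qed.

Section Counting.
Variables (p d : nat) (hp : prime p) (i0 : 'I_d).
Local Notation M := 'M[padic_int p]_d.
Implicit Types (g h : M).

Let p_gt0 : (0 < p)%N := prime_gt0 hp.

Lemma pdvd_unitK n (u x : padic_int p) : pdvd 1 (u - 1) -> pdvd n (x * u) -> pdvd n x.
Proof.
move=> u1; have [y uy _] := padic_inv hp u1; move=> xu.
by rewrite -(mulr1 x) -uy mulrA; exact: pdvdMr.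
Qed.

Lemma cofactor_G1 g : G1 g -> pdvd 1 (cofactor g i0 i0 - 1).
Proof.
move=> gG; have -> : 1 = cofactor 1%:M i0 i0 :> padic_int p.
  by have := mul_mx_adj (1%:M : M) => /matrixP/(_ i0 i0); rewrite mul1mx det1 !mxE eqxx.
by apply: mxcong_cofactor => a b _ _; have /GnP[_] := gG; exact.
Qed.

(* The corner entry is determined by the others through [\det g = 1]. *)
Lemma mxcong_corner n g h : G1 g -> G1 h ->
    (forall a b, (a, b) != (i0, i0) -> pdvd n (g a b - h a b)) -> mxcong n g h.
Proof.
move=> gG hG gh a b; have [[-> ->]|] := eqVneq (a, b) (i0, i0); last exact: gh.
have /GnP[g1 _] := gG; have /GnP[h1 _] := hG.
apply: (pdvd_unitK (cofactor_G1 gG)).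
have : \det g - \det h = 0 by rewrite g1 h1 subrr.
rewrite (expand_det_row _ i0) (expand_det_row h i0) -sumrB (bigD1 i0) //= => e.
have cof j : pdvd n (cofactor g i0 j - cofactor h i0 j).
  by apply: mxcong_cofactor => i k ii _; apply: gh; rewrite xpair_eqE (negPf ii).
have -> : (g i0 i0 - h i0 i0) * cofactor g i0 i0 =
  (g i0 i0 * cofactor g i0 i0 - h i0 i0 * cofactor h i0 i0) -
   h i0 i0 * (cofactor g i0 i0 - cofactor h i0 i0) by ring.
apply: pdvdB; last exact: pdvdMl.
move/eqP: e; rewrite addr_eq0 => /eqP ->; apply/pdvdN/pdvd_sum => j ji.
have -> : g i0 j * cofactor g i0 j - h i0 j * cofactor h i0 j =
  (g i0 j - h i0 j) * cofactor g i0 j + h i0 j * (cofactor g i0 j - cofactor h i0 j) by ring.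
apply: pdvdD; last exact: pdvdMl.
by apply/pdvdMr/gh; rewrite xpair_eqE (negPf ji) andbF.
Qed.

Section Cosets.
Variables (n : nat) (H : set M).
Hypothesis H1 : H 1%:M.
Hypothesis HG : forall z h, Gn n z -> H h -> H (z *m h).

Lemma coset_eq g h : G1 g -> G1 h -> mxcong n g h ->
  setmul [set g] H = setmul [set h] H.
Proof.
move=> gG hG gh; have /GnP[g1 _] := gG; have /GnP[h1 _] := hG.
have sub x y : \det x = 1 -> \det y = 1 -> mxcong n x y ->
    setmul [set x] H `<=` setmul [set y] H.
  move=> x1 y1 xy _ [_ /= -> [k Hk <-]]; have [z zn ->] := mxcong_coset x1 y1 xy.
  by exists y => //; exists (z *m k); [exact: HG|rewrite mulmxA].
by apply/seteqP; split; apply: sub => //; exact: mxcong_sym.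
Qed.

Lemma mem_coset g : setmul [set g] H g.
Proof. by exists g => //; exists 1%:M => //; rewrite mulmx1. Qed.

Definition residues g : {ffun 'I_d * 'I_d -> 'I_(p ^ n)} :=
  [ffun q => Ordinal (padic_res_lt hp (g q.1 q.2) n)].

Lemma residues_eq g h : residues g = residues h -> mxcong n g h.
Proof.
move=> e a b; apply/padic_res_eq => //; move/ffunP: e => /(_ (a, b)).
by rewrite !ffunE => /(congr1 val).
Qed.

(** A coset is determined by the residues modulo p^n of any representative. Finiteness makes
    [group_index] a genuine count. *)
Lemma finite_cosets : finite_set (left_cosets (@G1 p d) H).
Proof.
pose F (r : {ffun 'I_d * 'I_d -> 'I_(p ^ n)}) :=
  setmul [set xget 1%:M [set g : M | G1 g /\ residues g = r]] H.
apply: (@sub_finite_set _ _ (F @` [set: {ffun 'I_d * 'I_d -> 'I_(p ^ n)}])).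
  move=> _ [g gG <-]; exists (residues g) => //; rewrite /F.
  have [hG rh] : [set h : M | G1 h /\ residues h = residues g]
      (xget 1%:M [set h : M | G1 h /\ residues h = residues g]).
    by apply: (@xgetPex _ 1%:M [set h : M | G1 h /\ residues h = residues g]); exists g.
  exact/coset_eq/residues_eq.
exact/finite_image/finite_finset.
Qed.

End Cosets.

(** A coset is determined by the d^2 - 1 entries away from the corner, and each of them, being known
    modulo p, has p^(n-1) possible residues. *)
Lemma index_Gn_le n : (0 < n)%N ->
  (group_index (@G1 p d) (@Gn p d n) <= p ^ ((d * d - 1) * n.-1))%N.
Proof.
move=> n_gt0; rewrite /group_index; set A := fset_set _.
pose Q := {q : 'I_d * 'I_d | q != (i0, i0)}.
have ltq (x : padic_int p) : (x n %/ p < p ^ n.-1)%N.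
  by rewrite ltn_divLR // -expnSr prednK // padic_res_lt.
pose rep (X : set M) : M := xget 1%:M [set g : M | G1 g /\ setmul [set g] (@Gn p d n) = X].
pose f (X : A) : {ffun Q -> 'I_(p ^ n.-1)} :=
  [ffun q => Ordinal (ltq (rep (val X) (val q).1 (val q).2))].
have finA : finite_set (left_cosets (@G1 p d) (@Gn p d n)).
  by apply: finite_cosets; exact: GnM.
have repP (X : A) : G1 (rep (val X)) /\ setmul [set rep (val X)] (@Gn p d n) = val X.
  apply: (@xgetPex _ 1%:M [set g : M | G1 g /\ setmul [set g] (@Gn p d n) = val X]).
  have := valP X; rewrite /A in_fset_set // inE => -[g gG gX].
  by exists g.
have finj : injective f.
  move=> X Y e; apply: val_inj; have [XG <-] := repP X; have [YG <-] := repP Y.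
  apply: (@coset_eq n) => //; first exact: GnM.
  apply: mxcong_corner => // a b ab; apply/padic_res_eq => //.
  move/ffunP: e => /(_ (exist _ (a, b) ab)); rewrite !ffunE => /(congr1 val) /= e.
  (* A residue modulo p^n is recovered from its quotient by p, which [f] records, and from its
     residue modulo p, which is that of the identity. *)
  rewrite (divn_eq (rep (val X) a b n) p) (divn_eq (rep (val Y) a b n) p) e.
  congr (_ + _)%N; have mod1 (x : padic_int p) : (x n %% p = x 1%N)%N.
    by have := @padic_res_modS _ hp x _ _ n_gt0; rewrite expn1.
  rewrite !mod1; apply/padic_res_eq => //.
  have := pdvdB (G1_entry a b XG) (G1_entry a b YG).
  by have -> : forall x y z : padic_int p, x - z - (y - z) = x - y by move=> *; ring.
have := leq_card f finj; rewrite card_ffun card_ord card_sig cardC1 card_prod card_ord.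
by rewrite -cardfE -expnM mulnC subn1.
Qed.

(** G(n) is normal: z t y = t (t^-1 z t) y. *)
Lemma diagT_Gn_closed n z h : Gn n z -> setmul (@diagT p d) (@Gn p d n) h ->
  setmul (@diagT p d) (@Gn p d n) (z *m h).
Proof.
move=> zn [t tT [y yn <-]]; have [tG _] := tT; have /GnP[t1 _] := tG; have /GnP[z1 zc] := zn.
exists t => //; exists (\adj t *m z *m t *m y); last first.
  by rewrite !mulmxA (SL_adjK t1).1 mul1mx.
apply: GnM yn; apply/GnP; split; first by rewrite !det_mulmx det_adj1 // z1 t1 !mulr1.
rewrite -(SL_adjK t1).2; apply: mxcongM (mxcong_refl _ _).
by rewrite -[X in mxcong _ _ X]mulmx1; apply: mxcongM zc; exact: mxcong_refl.
Qed.

Lemma diagT_Gn1 n : setmul (@diagT p d) (@Gn p d n) 1%:M.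
Proof.
exists 1%:M; first by split; [exact: Gn1|exact: scalar_mx_is_diag].
by exists 1%:M; [exact: Gn1|rewrite mulmx1].
Qed.

(* Unit-diagonal matrices with off-diagonal entries in pZ, one column rescaled to
   determinant 1, are pairwise inequivalent modulo [diagT]. *)
Lemma index_diagT_Gn_ge n : (0 < n)%N ->
  (p ^ ((d * d - d) * n.-1) <=
     group_index (@G1 p d) (setmul (@diagT p d) (@Gn p d n)))%N.
Proof.
move=> n_gt0; rewrite /group_index; set H := setmul _ _; set A := fset_set _.
pose Q := {q : 'I_d * 'I_d | q.1 != q.2}.
pose Y (X : {ffun Q -> 'I_(p ^ n.-1)}) : M := \matrix_(i, j)
  if insub (i, j) is Some q then (p * X q)%:R else 1.
have Yd X i : Y X i i = 1 by rewrite mxE insubF //= eqxx.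
have Yo X i j (ij : i != j) : Y X i j = (p * X (exist _ (i, j) ij))%:R.
  by rewrite mxE insubT.
have Y1 X : mxcong 1 (Y X) 1%:M.
  move=> i j; rewrite [1%:M i j]mxE; have [<-|ij] := eqVneq i j.
    by rewrite Yd subrr; exact: pdvd0.
  by rewrite Yo subr0 natrM -(expr1 (p%:R)); exact/pdvdMr/pdvd_pX.
have detY X : pdvd 1 (\det (Y X) - 1) by rewrite -(det1 _ d); exact: mxcong_det.
have /choice[y yP] : forall X, exists y, \det (Y X) * y = 1 /\ pdvd 1 (y - 1).
  by move=> X; have [y ? ?] := padic_inv hp (detY X); exists y.
pose e X (j : 'I_d) := if j == i0 then y X else 1.
have e1 X j : pdvd 1 (e X j - 1).
  by rewrite /e; case: ifP => _; [exact: (yP X).2|rewrite subrr; exact: pdvd0].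
pose gX X : M := Y X *m dgmx (e X).
have gXE X i j : gX X i j = Y X i j * e X j by rewrite /gX mul_mx_diag !mxE.
have gG X : G1 (gX X).
  apply/GnP; split.
    rewrite det_mulmx det_diag (eq_bigr (e X)) => [|j _]; last by rewrite mxE.
    by rewrite prod_if_eq (yP X).1.
  rewrite -[X in mxcong _ _ X](mulmx1 1%:M); apply: mxcongM => // i j.
  rewrite dgmxE mxE; case: (i =P j) => _; first exact: e1.
  by rewrite subrr; exact: pdvd0.
have finA : finite_set (left_cosets (@G1 p d) H).
  by apply: finite_cosets; exact: diagT_Gn_closed.
have inA X : setmul [set gX X] H \in A by rewrite in_fset_set // inE; exists (gX X).
pose f X : A := [` inA X]%fset.
have finj : injective f.
  move=> X X' /(congr1 val) /= eX.
  (* Equality of cosets gives [gX X = gX X' *m (t *m z)] with t diagonal and z in G(n). *)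
  have : setmul [set gX X'] H (gX X) by rewrite -eX; exact/mem_coset/diagT_Gn1.
  case=> _ /= -> [_ [t [tG tdiag] [z zn <-]] gE].
  have cong i j : pdvd n (Y X i j * e X j - Y X' i j * (e X' j * t j j)).
    have -> : Y X' i j * (e X' j * t j j) = (gX X' *m t) i j.
      rewrite [RHS]mxE (bigD1 j) //= gXE mulrA big1 ?addr0 // => k kj.
      by rewrite (is_diag_mxP tdiag) ?mulr0 //; apply: contraNneq kj => /val_inj ->.
    rewrite -gXE -gE mulmxA; move: i j; rewrite -/(mxcong n _ _).
    rewrite -[X in mxcong _ _ X]mulmx1; apply: mxcongM; first exact: mxcong_refl.
    by have /GnP[] := zn.
  apply/ffunP => -[[i j] ij]; apply: val_inj => /=.
  (* The diagonal of Y is 1, so the diagonal entries identify the two scalings of column j modulo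
     p^n; the unit can then be cancelled off the diagonal. *)
  have cj := cong j j; rewrite !Yd !mul1r in cj.
  have : pdvd n ((Y X i j - Y X' i j) * e X j).
    have -> : (Y X i j - Y X' i j) * e X j =
      (Y X i j * e X j - Y X' i j * (e X' j * t j j)) - Y X' i j * (e X j - e X' j * t j j) by ring.
    by apply: pdvdB => //; exact: pdvdMl.
  move/(pdvd_unitK (e1 X j)) => /(padic_res_eq hp); rewrite (Yo X i j ij) (Yo X' i j ij) !padic_res_natr //.
  have ltp (x : 'I_(p ^ n.-1)) : (p * x < p ^ n)%N.
    have -> : (p ^ n = p * p ^ n.-1)%N by rewrite -expnS prednK.
    by rewrite ltn_pmul2l.
  by rewrite !modn_small // => /eqP; rewrite eqn_pmul2l // => /eqP.
have := leq_card f finj; rewrite -cardfE; apply: leq_trans.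
rewrite card_ffun card_ord card_sig -expnM mulnC leq_exp2l ?prime_gt1 // leq_mul2l.
apply/orP; right; have := cardC [pred q : 'I_d * 'I_d | q.1 != q.2].
rewrite card_prod card_ord => <-; rewrite leq_subLR addnC leq_add2r.
apply: (@leq_trans #|codom (fun a : 'I_d => (a, a))|).
  apply/subset_leq_card/fintype.subsetP => -[a b]; rewrite !inE negbK /= => /eqP <-.
  exact: codom_f.
by rewrite card_codom ?card_ord // => a b [].
Qed.

End Counting.

(** * Reduction to a finite-dimensional representation *)

Section Edim.
Variables (R : realType) (F : fieldType) (L : lmodType F) (W : set L).

Lemma edim_le_basis m (e : 'I_m -> L) (r : R) : is_basis W e -> m%:R <= r ->
  (edim R W <= r%:E)%E.
Proof.
move=> We mr; apply: (@le_trans _ _ (m%:R%:E)%E); last by rewrite lee_fin.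
by apply: ereal_inf_lbound; exists m => //; exists e.
Qed.

(** A finite bound excludes the empty infimum, and an infimum of natural numbers is attained. *)
Lemma edim_le_exists (r : R) : (edim R W <= r%:E)%E ->
  exists m (e : 'I_m -> L), is_basis W e /\ m%:R <= r.
Proof.
rewrite /edim => le; pose P m := exists e : 'I_m -> L, is_basis W e.
have [exP|nP] := pselect (exists m, P m); last first.
  move: le; rewrite (_ : [set m%:R%:E | m in _] = set0) ?ereal_inf0 //.
  by rewrite -subset0 => x [m Pm _]; apply: nP; exists m.
have exP' : exists m, `[< P m >] by case: exP => m Pm; exists m; exact/asboolP.
have [m /asboolP[e We] mmin] := ex_minnP exP'.
exists m, e; split=> //; rewrite -lee_fin; apply: le_trans le.
apply: le_ereal_inf_tmp => _ [k Pk <-]; rewrite lee_fin ler_nat; exact/mmin/asboolP.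
Qed.

End Edim.

Section Coordinates.
Variables (F : fieldType) (L : lmodType F) (V : vectType F) (phi : {linear V -> L}).
Hypothesis phi_inj : injective phi.

(** The coordinates of a basis of U in the family [e] form a matrix with independent rows, so its
    height is at most r. *)
Lemma dim_le_spanning (U : {vspace V}) (W : set L) r (e : 'I_r -> L) :
    is_basis W e -> (forall v, v \in U -> W (phi v)) -> (\dim U <= r)%N.
Proof.
move=> [_ _ span] UW; pose X := vbasis U.
have /choice[b bE] : forall i : 'I_(\dim U), exists b : 'I_r -> F,
    phi X`_i = \sum_k b k *: e k.
  by move=> i; apply/span/UW/vbasis_mem/mem_nth; rewrite size_tuple.
pose B : 'M[F]_(\dim U, r) := \matrix_(i, k) b i k.
suff /eqP <- : row_free B by exact: rank_leq_col.
apply: inj_row_free => x xB.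
have : phi (\sum_i x 0 i *: X`_i) = 0.
  rewrite linear_sum (eq_bigr (fun i => \sum_k (x 0 i * B i k) *: e k)) => [|i _].
    rewrite exchange_big big1 //= => k _; rewrite -scaler_suml.
    by have := congr1 (fun y : 'rV[F]_r => y 0 k) xB; rewrite !mxE => ->; rewrite scale0r.
  rewrite linearZ /= bE scaler_sumr; apply: eq_bigr => k _.
  by rewrite scalerA mxE.
rewrite -(linear0 phi) => /phi_inj x0; apply/rowP => i; rewrite mxE.
have /freeP Xfree : free X by exact: basis_free (vbasisP U).
exact: (Xfree (fun j => x 0 j)).
Qed.

Lemma basis_of_vspace (U : {vspace V}) (W : set L) :
    (forall v, v \in U -> W (phi v)) ->
    (forall w, W w -> exists2 v, v \in U & w = phi v) ->
  is_basis W (fun i : 'I_(\dim U) => phi (vbasis U)`_i).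
Proof.
move=> UW WU; split.
- by move=> i; apply/UW/vbasis_mem/mem_nth; rewrite size_tuple.
- have /freeP Xfree : free (vbasis U) by exact: basis_free (vbasisP U).
  move=> c c0; apply: Xfree; apply: phi_inj; rewrite linear0 linear_sum -[RHS]c0.
  by apply: eq_bigr => i _; rewrite linearZ.
- move=> _ /WU[v vU ->]; exists (fun i => coord (vbasis U) i v).
  rewrite {1}(coord_vbasis vU) linear_sum.
  by apply: eq_bigr => i _; rewrite linearZ.
Qed.

End Coordinates.

(** Over F_p the row space is finite, so the subspace is the span of an enumeration of its
    elements. *)
Lemma vspace_of_prop (p m : nat) (P : 'rV['F_p]_m -> Prop) : P 0 ->
    (forall a u v, P u -> P v -> P (a *: u + v)) ->
  exists U : {vspace 'rV['F_p]_m}, forall v, v \in U <-> P v.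
Proof.
move=> P0 Plin; pose X := [seq v <- enum 'rV['F_p]_m | `[< P v >] ].
exists <<X>>%VS => v; split=> [|Pv]; last first.
  by apply: memv_span; rewrite mem_filter mem_enum andbT; apply/asboolP.
move=> /(coord_span (X := in_tuple X)) ->.
apply: big_ind => [//|u w Pu Pw|i _]; first by rewrite -(scale1r u); exact: Plin.
rewrite -[_ *: _]addr0; apply: Plin => //.
have : (in_tuple X)`_i \in X by apply: mem_nth.
by rewrite mem_filter => /andP[/asboolP].
Qed.

Section FiniteModel.
Variables (p d : nat) (hp : prime p) (i0 : 'I_d).
Hypothesis i0E : i0 = 0%N :> nat.
Local Notation M := 'M[padic_int p]_d.
Variables (L : lmodType 'F_p) (rho : M -> {linear L -> L}).
Hypothesis hrho : is_repr (@G1 p d) rho.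

(** Normality of G(n) in the form h g = g z with z in G(n). *)
Lemma fixed_stable n g w : (0 < n)%N -> G1 g -> fixed rho (@Gn p d n) w ->
  fixed rho (@Gn p d n) (rho g w).
Proof.
move=> n_gt0 gG wn h hn; have [_ rhoM] := hrho.
have hG : G1 h by exact: Gn_le hn.
have /GnP[g1 _] := gG; have /GnP[h1 hc] := hn.
have hg1 : \det (h *m g) = 1 by rewrite det_mulmx h1 g1 mulr1.
have hgg : mxcong n (h *m g) g.
  by rewrite -[X in mxcong _ _ X]mul1mx; apply: mxcongM => //; exact: mxcong_refl.
have [z zn hgE] := mxcong_coset hg1 g1 hgg.
rewrite -rhoM // hgE rhoM ?(wn z zn) //; exact: Gn_le zn.
Qed.

(** L^G(n) is stable under G, so in the coordinates of the basis [e] the group acts by matrices;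
    outside G the matrix is set to 0. *)
Lemma finite_model n m (e : 'I_m -> L) : (0 < n)%N -> is_basis (fixed rho (@Gn p d n)) e ->
  exists (phi : {linear 'rV['F_p]_m -> L}) (rhoV : M -> 'End('rV['F_p]_m))
    (fixs : set M -> {vspace 'rV['F_p]_m}),
  [/\ injective phi,
      forall w, fixed rho (@Gn p d n) w <-> exists v, w = phi v,
      forall g v, G1 g -> phi (rhoV g v) = rho g (phi v)
    & forall H v, v \in fixs H <-> forall g, H g -> rhoV g v = v].
Proof.
move=> n_gt0 [eW efree espan].
pose f (v : 'rV['F_p]_m) := \sum_i v 0 i *: e i.
have flin : linear f.
  move=> a u v; rewrite /f scaler_sumr -big_split /=; apply: eq_bigr => i _.
  by rewrite !mxE scalerDl scalerA.
pose fL := GRing.isLinear.Build _ _ _ _ f flin.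
pose phi : {linear 'rV['F_p]_m -> L} := HB.pack f fL.
have phiE v : phi v = \sum_i v 0 i *: e i by [].
have phi_inj : injective phi.
  apply: raddf_inj => v phiv0; have /efree v0 : \sum_i v 0 i *: e i = 0 by exact: phiv0.
  by apply/rowP => i; rewrite v0 mxE.
have img w : fixed rho (@Gn p d n) w <-> exists v, w = phi v.
  split=> [/espan[c ->]|[v ->] g gn].
    by exists (\row_i c i); rewrite phiE; apply: eq_bigr => i _; rewrite mxE.
  rewrite phiE linear_sum; apply: eq_bigr => i _; rewrite linearZ /=.
  by rewrite eW.
have /choice[A AE] : forall g, exists A : 'M['F_p]_m, G1 g ->
    forall v, phi (v *m A) = rho g (phi v).
  move=> g; have [gG|ngG] := pselect (G1 g); last by exists 0.
  have /choice[b bE] : forall i, exists b : 'I_m -> 'F_p, rho g (e i) = \sum_k b k *: e k.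
    by move=> i; apply/espan/fixed_stable.
  exists (\matrix_(i, k) b i k) => _ v; rewrite !phiE linear_sum.
  rewrite [RHS](eq_bigr (fun i => \sum_k (v 0 i * b i k) *: e k)) => [|i _]; last first.
    by rewrite linearZ /= bE scaler_sumr; apply: eq_bigr => k _; rewrite scalerA.
  rewrite exchange_big /=; apply: eq_bigr => k _; rewrite -scaler_suml mxE.
  by congr (_ *: _); apply: eq_bigr => i _; rewrite mxE.
pose rhoV g : 'End('rV['F_p]_m) := linfun (mulmxr (A g)).
have rhoVE g v : rhoV g v = v *m A g by rewrite lfunE.
have /choice[fixs fixsP] : forall H : set M, exists U : {vspace 'rV['F_p]_m},
    forall v, v \in U <-> forall g, H g -> rhoV g v = v.
  move=> H; apply: vspace_of_prop => [g _|a u v uH vH g Hg]; first by rewrite linear0.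
  by rewrite linearP /= uH // vH.
exists phi, rhoV, fixs; split=> // g v gG; rewrite rhoVE; exact: AE.
Qed.

(** Keep the diagonal of g, except that the corner is replaced by the inverse of the product of the
    other entries. This has determinant 1, and the corner congruence then follows from the
    others. *)
Lemma patternG_sub_diagT n : (0 < n)%N ->
  @patternG p d i0 1 1 n `<=` setmul (@diagT p d) (@Gn p d n).
Proof.
move=> n_gt0 g Kg; have gG := Kg.1.
have Pp : pdvd 1 (\prod_(j < d | j != i0) g j j - 1).
  rewrite -big_filter; apply: pdvd_prod1 => j.
  by have := G1_entry j j gG; rewrite eqxx.
have [y Py y1] := padic_inv hp Pp.
pose e (j : 'I_d) := if j == i0 then y else g j j.
have tG : G1 (dgmx e).
  apply: Gn_dgmx => [j|].
    rewrite /e; case: ifP => _ //.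
    by have := G1_entry j j gG; rewrite eqxx.
  rewrite (bigD1 i0) //= {1}/e eqxx (eq_bigr (fun j => g j j)) => [|j /negPf ji].
    by rewrite mulrC.
  by rewrite /e ji.
have cong : mxcong n g (dgmx e).
  apply: (mxcong_corner hp gG tG) => a b ab; rewrite dgmxE.
  have [eab|nab] := eqVneq a b.
    subst b; rewrite mulr1n /e; have -> : (a == i0) = false.
      by apply: contraNF ab => /eqP ->.
    by rewrite subrr; exact: pdvd0.
  by rewrite subr0; exact: patternG_off Kg nab.
have /GnP[g1 _] := gG; have /GnP[t1 _] := tG.
have [z zn ->] := mxcong_coset g1 t1 cong.
exists (dgmx e); last by exists z.
by split=> //; exact: diag_mx_is_diag.
Qed.

(** Shows that H(c+1, 1, j) lies in H(c, k, j), which supplies the base bound at each stage of the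
    recursion. *)
Lemma level_monotone c k j (a b : 'I_d) : (k <= j)%N ->
  (level c k j a b <= level c.+1 1 j a b)%N.
Proof.
move=> kj; rewrite /level ltnS; case: (a != b) => //.
case: ltnP => [ac|_]; first by rewrite (ltnW ac).
by case: eqP => [->|_]; rewrite ?leqnn.
Qed.

End FiniteModel.

(** * From the recursion to the bound for T G(n) *)

Theorem theorem3p1 (R : realType) (d p : nat)
  (hd : (2 <= d)%N) (hp : prime p) (hpd : (d < p)%N)
  (L : lmodType 'F_p) (rho : 'M[padic_int p]_d -> {linear L -> L})
  (hrho : is_repr (@G1 p d) rho)
  (hL : exists2 C : R, 0 < C & forall n : nat, (1 <= n)%N ->
     (edim R (fixed rho (@Gn p d n))
        <= (C * p%:R ^- n * (group_index (@G1 p d) (@Gn p d n))%:R)%:E)%E) :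
  exists2 C : R, 0 < C & forall n : nat, (1 <= n)%N ->
     (edim R (fixed rho (setmul (@diagT p d) (@Gn p d n)))
        <= (C * 10 ^+ ((d - 1) * n)
              * p%:R `^ (- ((2 / 3) ^+ (d - 1) * n%:R))
              * (group_index (@G1 p d) (setmul (@diagT p d) (@Gn p d n)))%:R)%:E)%E.
Proof.
have p_gt0 := prime_gt0 hp; have P0 : 0 < p%:R :> R by rewrite ltr0n.
pose i0 : 'I_d := Ordinal (ltnW hd); have i0E : i0 = 0%N :> nat by [].
have [C C0 hC] := hL.
have hbasis j : (0 < j)%N -> exists m (e : 'I_m -> L), is_basis (fixed rho (@Gn p d j)) e /\
    m%:R <= C * p%:R ^- j * p%:R ^+ ((d * d - 1) * j.-1).
  move=> j0; have [m [e [eb em]]] := edim_le_exists (hC j j0).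
  exists m, e; split=> //; apply: le_trans em _; rewrite ler_wpM2l //.
    by rewrite mulr_ge0 ?(ltW C0) // invr_ge0 exprn_ge0.
  by rewrite -natrX ler_nat; apply: index_Gn_le hp i0 _ j0.
have [C' C'0 HC'] := recursion_bound hd p_gt0 C0.
exists C' => // n n0.
(* All fixed spaces of levels j <= n are studied inside L^G(n); the constant [C'] was fixed before
   this choice of n. *)
have [m [e [eb _]]] := hbasis n n0.
have [phi [rhoV [fixs [phi_inj img phiM fixsP]]]] := finite_model hrho n0 eb.
have [rho1' rhoM'] := hrho.
have rhoV1 v : rhoV 1%:M v = v.
  by apply: phi_inj; rewrite phiM ?rho1' //; exact: Gn1.
have rhoVM g h : G1 g -> G1 h -> forall v, rhoV (g *m h) v = rhoV g (rhoV h v).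
  by move=> gG hG v; apply: phi_inj; rewrite !phiM // ?rhoM' //; exact: GnM.
have fixs_phi (H : set 'M[padic_int p]_d) v : H `<=` @G1 p d ->
    v \in fixs H <-> fixed rho H (phi v).
  move=> HG; rewrite fixsP; split=> vH g Hg.
    by rewrite -phiM ?vH //; exact: HG.
  by apply: phi_inj; rewrite phiM ?vH //; exact: HG.
have GnG j : (0 < j)%N -> @Gn p d j `<=` @G1 p d by move=> j0 g; exact: Gn_le.
pose D c k j := \dim (fixs (@patternG p d i0 c k j)).
have HD : (D 1%N 1%N n)%:R <= C' * rate R p d.-1 ^+ n * p%:R ^+ ((d * d - d) * n.-1).
  apply: (HC' n D) => [j /andP[j0 jn]|c k j cd kj jn|c k j /andP[c0 cd] /andP[k0 kj] jn|]; last by rewrite n0 leqnn.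
  - have [r [e' [eb' er]]] := hbasis j j0.
    apply: le_trans er; rewrite ler_nat.
    (* The base c = d: H(d, 1, j) contains G(j), to which the hypothesis on L applies. *)
    apply: leq_trans (_ : \dim (fixs (@Gn p d j)) <= r)%N.
      by apply/dimvS/(fixsS fixsP) => g; apply: Gn_patternG.
    apply: (dim_le_spanning phi_inj eb') => v; rewrite fixs_phi //; exact: GnG.
  - apply/dimvS/(fixsS fixsP) => g [gG gK]; split=> // a b.
    by apply: pdvd_le (gK a b); apply: level_monotone; case/andP: kj.
  - exact: (fixed_dim_step hp rhoV1 rhoVM fixsP i0E (c := Ordinal cd) c0
      (leq_ltn_trans cd hpd) k0 kj).
have TGG : setmul (@diagT p d) (@Gn p d n) `<=` @G1 p d.
  by move=> _ [t [tG _] [z zn <-]]; apply: GnM => //; exact: GnG zn.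
pose U := fixs (setmul (@diagT p d) (@Gn p d n)).
have basisU : is_basis (fixed rho (setmul (@diagT p d) (@Gn p d n)))
    (fun i : 'I_(\dim U) => phi (vbasis U)`_i).
  apply: basis_of_vspace => // [v|w wT]; first by rewrite fixs_phi.
  (* T G(n) contains G(n), so its fixed vectors lie in the image of the model. *)
  have [v wv] : exists v, w = phi v.
    apply/img => g gn; apply: wT; exists 1%:M.
      by split; [exact: Gn1|exact: scalar_mx_is_diag].
    by exists g => //; rewrite mul1mx.
  by exists v => //; apply/fixs_phi => //; rewrite -wv.
apply: (edim_le_basis basisU).
apply: (@le_trans _ _ (D 1%N 1%N n)%:R).
  (* H(1, 1, n) is contained in T G(n), so it fixes at least as many vectors. *)
  by rewrite ler_nat; apply/dimvS/(fixsS fixsP)/(patternG_sub_diagT hp).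
apply: le_trans HD _; apply: ler_pM.
- by rewrite mulr_ge0 ?(ltW C'0) // exprn_ge0 // ltW // rate_gt0.
- exact: exprn_ge0.
- rewrite /rate exprMn -exprM subn1 mulrA.
  by rewrite -(powR_mulrn n (powR_ge0 _ _)) -powRrM mulNr.
- by rewrite -natrX ler_nat; apply: index_diagT_Gn_ge hp i0 _ n0.
Qed.
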